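(* Let $\eta$ be a nonconvex standard polygonal escape path (for the triangle $\mathcal K$ of the context) that is length-minimal among escape paths with at most $N$ segments. Then there exist a gap $FT$ of $\eta$, a hull vertex $M$ opposite to it, and two parallel support lines of the hull of $\eta$ at distance $h>0$ (one containing $F,T$, the other containing $M$) such that, after a rigid normalization, $$F=(x_F,0),\quad T=(x_T,0),\quad M=(x_M,h),\qquad x_F\le x_T,\qquad F\prec M\prec T,$$ and $$\operatorname{len}(\eta)\ge(1+\sqrt2)\,h.$$
   Context: $\mathcal K=\operatorname{conv}\{(-c,0),(c,0),(0,s)\}$ with $s=\frac{766}{\sqrt{625565}}$, $c=\frac{197}{\sqrt{625565}}$. A path is an escape path (for $\mathcal K$) if no translated and rotated copy of it lies in the interior of $\mathcal K$. A polygonal path is standard if it is simple and its nonrepeated vertices are exactly the extreme vertices of its convex hull, each visited once. A hull edge not traversed by the path is a gap. A standard path is convex if its links follow one hull-boundary chain between its endpoints, and nonconvex otherwise. $X\prec Y$ means that the path visits $X$ strictly before $Y$. A rigid normalization is an isometric change of coordinates of the plane (reflections allowed); after it the two support lines are $y=0$ and $y=h$ and the hull lies in $0\le y\le h$. *)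

(* Defs.v *)
From mathcomp Require Export all_boot all_order all_algebra.
From mathcomp Require Export all_classical all_reals all_analysis.
Export Order.TTheory GRing.Theory Num.Theory.
Export numFieldNormedType.Exports.

Set Implicit Arguments.
Unset Strict Implicit.
Unset Printing Implicit Defensive.

Local Open Scope classical_set_scope.
Local Open Scope ring_scope.

(* Points are pairs of reals. Only the topology of the product [R * R] is used:
   its library norm is the sup norm, so the Euclidean distance is [edist]. *)
Section PlaneGeometry.
Variable R : realType.
Local Notation plane := (R * R)%type.
Implicit Types (a b u x y X Y : plane) (A L : set plane) (c h : R).

Definition dotp u x : R := u.1 * x.1 + u.2 * x.2.

Definition edist x y : R :=
  Num.sqrt ((x.1 - y.1) ^+ 2 + (x.2 - y.2) ^+ 2).

Definition isometry (phi : plane -> plane) : Prop :=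
  forall x y, edist (phi x) (phi y) = edist x y.

Definition segment_point a b (t : R) : plane := (1 - t) *: a + t *: b.

Definition segment a b : set plane :=
  [set x | exists2 t : R, 0 <= t <= 1 & x = segment_point a b t].

Definition hull A : set plane := smallest (@convex_set R plane) A.

Definition extreme_point A x : Prop :=
  A x /\ forall y z (t : R), A y -> A z -> 0 < t < 1 ->
    x = segment_point y z t -> y = x /\ z = x.

Definition line u c : set plane := [set x | dotp u x = c].

Definition support_line A L : Prop :=
  exists u c, [/\ u != 0, L = line u c, L `&` A !=set0 &
    forall x, A x -> c <= dotp u x].

Definition parallel_at_distance h L0 L1 : Prop :=
  exists u c, [/\ dotp u u = 1, L0 = line u c & L1 = line u (c + h)].

(* A one-dimensional face. *)
Definition hull_edge A X Y : Prop :=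
  X != Y /\ exists2 L, support_line A L & L `&` A = segment X Y.

Implicit Type p : seq plane.

(* A polygonal path is the list of its successive vertices; its links join
   consecutive vertices, numbered from 0. *)
Definition links p : nat := (size p).-1.

Definition vertex p (i : nat) : plane := nth 0 p i.

Definition link_point p (i : nat) (t : R) : plane :=
  segment_point (vertex p i) (vertex p i.+1) t.

Definition path_image p : set plane :=
  [set x | exists2 i, (i < links p)%N &
     segment (vertex p i) (vertex p i.+1) x].

Definition path_hull p : set plane := hull (path_image p).

Definition len p : R :=
  \sum_(i < links p) edist (vertex p i) (vertex p i.+1).

Definition closed_path p : bool := vertex p 0 == vertex p (links p).

(* The parametrization of the path on [0, links p], linear on each
   [i, i + 1], is injective, except that both ends may coincide. *)
Definition simple_path p : Prop :=
  forall (i j : nat) (s t : R), (i < links p)%N -> (j < links p)%N ->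
    0 <= s <= 1 -> 0 <= t <= 1 -> link_point p i s = link_point p j t ->
    [\/ i%:R + s = j%:R + t,
        i%:R + s = 0 /\ j%:R + t = (links p)%:R |
        j%:R + t = 0 /\ i%:R + s = (links p)%:R].

(* On a closed path the common endpoint is listed once. *)
Definition nonrepeated_vertices p : seq plane :=
  if closed_path p then behead p else p.

Definition standard p : Prop :=
  [/\ (1 < size p)%N, simple_path p, uniq (nonrepeated_vertices p) &
      [set` nonrepeated_vertices p] = extreme_point (path_hull p)].

(* Consecutive links share a vertex and a simple path never turns back, so
   links that are all hull edges form a single chain of the hull boundary. *)
Definition convex_path p : Prop :=
  forall i, (i < links p)%N ->
    hull_edge (path_hull p) (vertex p i) (vertex p i.+1).

Definition nonconvex_standard p : Prop := standard p /\ ~ convex_path p.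

Definition traverses p X Y : Prop :=
  exists2 i, (i < links p)%N &
    (vertex p i = X /\ vertex p i.+1 = Y) \/
    (vertex p i = Y /\ vertex p i.+1 = X).

Definition gap p X Y : Prop :=
  hull_edge (path_hull p) X Y /\ ~ traverses p X Y.

Definition precedes p X Y : Prop :=
  [/\ X \in p, Y \in p & (index X p < index Y p)%N].

(* Rotation by the angle with cosine [c] and sine [s], then translation. *)
Definition rigid_motion (c s : R) (v x : plane) : plane :=
  (c * x.1 - s * x.2, s * x.1 + c * x.2) + v.

(* The square root of 625565, split to keep the unary numerals small. *)
Definition norm_const : R := Num.sqrt (625 * 1000 + 565).

Definition K_triangle : set plane :=
  hull [set (- (197 / norm_const), 0); (197 / norm_const, 0);
            (0, 766 / norm_const)].

Definition escape_path p : Prop :=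
  (1 < size p)%N /\
  forall (c s : R) (v : plane), c ^+ 2 + s ^+ 2 = 1 ->
    ~ (rigid_motion c s v @` path_image p `<=` K_triangle°).

Definition length_minimal (N : nat) p : Prop :=
  [/\ escape_path p, (links p <= N)%N &
      forall q, escape_path q -> (links q <= N)%N -> len p <= len q].

End PlaneGeometry.

(* Main.v *)
Require Import Defs.
From mathcomp Require Import ring lra zify.
Local Open Scope classical_set_scope.
Local Open Scope ring_scope.
Set Implicit Arguments.
Unset Strict Implicit.
Unset Printing Implicit Defensive.

(** The triangle enters only through the convexity of its interior: replacing
a path by one whose hull contains it preserves escaping, so a length-minimal
path cannot be shortened while its hull grows.

This gives a first-order condition at each vertex V.  Pushing V straight away
from another vertex W keeps the old V in the hull, as V lies between W and its
new position.  Hence the push cannot shorten the path: the unit vectors from V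
to its neighbours on the path have a sum with nonnegative inner product with
W - V.  Together with the convex position of the vertices and the fact that a
link of a simple path keeps all earlier vertices on one side and all later ones
on one side, this is what the predicate [taut] records, and the rest of the
argument uses nothing else.

Existence of the gap ([middle_gap]).  The first vertex is the start of some
gap, and no farthest vertex precedes it.  Given a gap F T whose farthest vertex
comes after T, let A precede T on the path.  The link A T separates the earlier
vertices from the later ones; if G is the outermost later vertex seen from A,
then A G is again a gap, its start comes later on the path, and comparing the
directions of the lines F T and A G shows that some vertex farthest from A G
comes after A.  So the process stops at a gap F T with a farthest vertex M
visited between F and T.  The gap found does not join the two ends of the path,
because a link that is not a hull edge separates these ends
([separating_link]); reversing the path if necessary, T is not the last vertex.

Length ([tail_length]).  From F to M the path has length at least h, and it
remains to find sqrt 2 * h from M onwards.  Let A be the predecessor of T, let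
a be the angle between T A and T F, and g the angle between T F and the
outgoing link at T.  The condition at T gives a + g <= pi.  If a is at most
pi / 4, the chord M T already suffices.  Otherwise let G be the outermost later
vertex seen from A.  The condition at G makes the angle A G T at most a right
angle, and two estimates follow: A M is inclined by at most pi / 4 - so it has
length at least sqrt 2 times its height ([descent_slope]) - and the broken line
A T G has length at least sqrt 2 times the height of A
([steep_links_length]). *)

(** * Taut polygonal paths *)

(* Preprocessing the hypotheses about reals would dominate the cost of lia. *)
Ltac idx_lia :=
  match goal with R : realType |- _ =>
    repeat match goal with H : context [R] |- _ => clear H end
  end; lia.

Section Taut.
Variable R : realType.
Local Notation plane := (R * R)%type.
Implicit Types (a b c d x y z : plane) (P : nat -> plane).

Definition orient a b c : R :=
  (b.1 - a.1) * (c.2 - a.2) - (b.2 - a.2) * (c.1 - a.1).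

Definition inner a b c : R :=
  (b.1 - a.1) * (c.1 - a.1) + (b.2 - a.2) * (c.2 - a.2).

(** The rate at which the distance from v to x grows when v is pushed away
    from w. *)
Definition pull v x w : R := inner v x w / edist v x.

(** The first variation of the length of the path P_0, ..., P_n under that push
    of its vertex P_i; the two ends have one neighbour only. *)
Definition total_pull n P i w : R :=
  (if (0 < i)%N then pull (P i) (P i.-1) w else 0) +
  (if (i < n)%N then pull (P i) (P i.+1) w else 0).

(** The combinatorial and first-order content of minimality.  They are
    stated with determinants and inner products of vertices so that they carry
    over directly to the reversed path and to its image under an isometry. *)
Record taut (n : nat) P : Prop := Taut {
  taut_convex : forall i j k l,
    (i <= n)%N -> (j <= n)%N -> (k <= n)%N -> (l <= n)%N ->
    0 < orient (P i) (P j) (P l) -> 0 < orient (P j) (P k) (P l) ->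
    0 < orient (P k) (P i) (P l) -> False;
  taut_noncollinear : forall i j k,
    (i <= n)%N -> (j <= n)%N -> (k <= n)%N ->
    i != j -> j != k -> i != k -> orient (P i) (P j) (P k) != 0;
  taut_side : forall i j k, (i < n)%N -> (j <= n)%N -> (k <= n)%N ->
    ((j < i) && (k < i) || (i.+1 < j) && (i.+1 < k))%N ->
    0 < orient (P i) (P i.+1) (P j) * orient (P i) (P i.+1) (P k);
  taut_pull : forall i j, (i <= n)%N -> (j <= n)%N -> i != j ->
    0 <= total_pull n P i (P j) }.

Lemma orient_rot a b c : orient a b c = orient b c a.
Proof. by rewrite /orient; ring. Qed.

Lemma orient_swap a b c : orient a b c = - orient b a c.
Proof. by rewrite /orient; ring. Qed.

Lemma orient_aba a b : orient a b a = 0.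
Proof. by rewrite /orient; ring. Qed.

Lemma orient_abb a b : orient a b b = 0.
Proof. by rewrite /orient; ring. Qed.

Lemma edistE a b : edist a b = Num.sqrt (inner a b b).
Proof. by rewrite /edist /inner; congr Num.sqrt; ring. Qed.

Lemma edist_ge0 a b : 0 <= edist a b.
Proof. exact: sqrtr_ge0. Qed.

Lemma edist_sqr a b : edist a b ^+ 2 = inner a b b.
Proof.
rewrite edistE sqr_sqrtr // /inner -!expr2; exact: addr_ge0 (sqr_ge0 _) (sqr_ge0 _).
Qed.

Lemma edistC a b : edist a b = edist b a.
Proof. by rewrite /edist; congr Num.sqrt; ring. Qed.

Lemma edist_gt0 a b : a != b -> 0 < edist a b.
Proof.
case: a b => [a1 a2] [b1 b2]; rewrite xpair_eqE negb_and => H.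
rewrite /edist sqrtr_gt0 /= lt0r addr_ge0 ?sqr_ge0 // andbT.
by rewrite paddr_eq0 ?sqr_ge0 // !sqrf_eq0 !subr_eq0 negb_and.
Qed.

Lemma edistxx a : edist a a = 0.
Proof. by rewrite /edist !subrr expr0n /= addr0 sqrtr0. Qed.

(** Cauchy-Schwarz: the defect of the squares is the squared determinant. *)
Lemma inner_le_edist a b c : inner a b c <= edist a b * edist a c.
Proof.
have [le0|gt0] := lerP (inner a b c) 0.
  exact: le_trans le0 (mulr_ge0 (edist_ge0 _ _) (edist_ge0 _ _)).
rewrite -(ler_pXn2r (n := 2)) ?nnegrE ?(ltW gt0) ?mulr_ge0 ?edist_ge0 //.
rewrite exprMn !edist_sqr -subr_ge0.
have -> : inner a b b * inner a c c - inner a b c ^+ 2 = orient a b c ^+ 2.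
  by rewrite /inner /orient; ring.
exact: sqr_ge0.
Qed.

Lemma edist_triangle a b c : edist a c <= edist a b + edist b c.
Proof.
have h : 0 <= edist a b + edist b c by rewrite addr_ge0 ?edist_ge0.
rewrite -(ler_pXn2r (n := 2)) ?nnegrE ?edist_ge0 // sqrrD !edist_sqr.
have := inner_le_edist b a c; rewrite (edistC b a) => H.
have -> : inner a c c = inner a b b + inner b c c - inner b a c *+ 2.
  by rewrite /inner; ring.
rewrite -subr_ge0.
have -> : inner a b b + (edist a b * edist b c) *+ 2 + inner b c c -
   (inner a b b + inner b c c - inner b a c *+ 2) =
   (edist a b * edist b c + inner b a c) *+ 2 by ring.
have H2 := inner_le_edist b (b.1 *+ 2 - a.1, b.2 *+ 2 - a.2) c.
have E1 : edist b (b.1 *+ 2 - a.1, b.2 *+ 2 - a.2) = edist a b.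
  by rewrite /edist /=; congr Num.sqrt; ring.
have E2 : inner b (b.1 *+ 2 - a.1, b.2 *+ 2 - a.2) c = - inner b a c.
  by rewrite /inner /=; ring.
by rewrite E1 E2 in H2; rewrite mulrn_wge0 //; lra.
Qed.

Lemma edist_le_path P i j : (i <= j)%N ->
  edist (P i) (P j) <= \sum_(i <= k < j) edist (P k) (P k.+1).
Proof.
elim: j => [|j IH]; first by rewrite leqn0 => /eqP ->; rewrite big_geq // edistxx.
rewrite leq_eqVlt => /predU1P[->|]; first by rewrite big_geq // edistxx.
rewrite ltnS => ij; rewrite big_nat_recr //=.
apply: le_trans (edist_triangle _ (P j) _) _.
by rewrite lerD2r IH.
Qed.

Lemma path_length_ge0 P i j : 0 <= \sum_(i <= k < j) edist (P k) (P k.+1).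
Proof. by apply: sumr_ge0 => k _; exact: edist_ge0. Qed.

Lemma argmax_nat (f : nat -> R) l n : (l <= n)%N ->
  exists2 m, (l <= m <= n)%N & forall k, (l <= k <= n)%N -> f k <= f m.
Proof.
elim: n => [|n IH].
  rewrite leqn0 => /eqP ->; exists 0%N => // k.
  by rewrite leqn0 => /eqP ->.
rewrite leq_eqVlt => /predU1P[->|].
  by exists n.+1; rewrite ?leqnn // => k; rewrite -eqn_leq => /eqP ->.
rewrite ltnS => ln; have [m lmn mmax] := IH ln.
have [le|lt] := lerP (f n.+1) (f m).
  exists m => [|k]; first by lia.
  have [->|kn] := eqVneq k n.+1; first by [].
  by move=> H; apply: mmax; lia.
exists n.+1 => [|k]; first by lia.
have [->|kn] := eqVneq k n.+1; first by [].
by move=> H; apply: le_trans (mmax k _) (ltW lt); lia.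
Qed.

Section Invariance.
Variables (n : nat) (P : nat -> plane).
Hypothesis tP : taut n P.

Lemma taut_rev : taut n (fun i => P (n - i)%N).
Proof.
split.
- by move=> i j k l _ _ _ _; apply: (taut_convex tP); lia.
- by move=> i j k ? ? ? ? ? ?; apply: (taut_noncollinear tP); lia.
- move=> i j k ilt jn kn H.
  rewrite (orient_swap (P (n - i)%N)) (orient_swap (P (n - i)%N)) mulrNN.
  have -> : (n - i = (n - i.+1).+1)%N by lia.
  by apply: (taut_side tP); lia.
- move=> i j ilen jlen ij.
  have := taut_pull tP (leq_subr i n) (leq_subr j n).
  have -> : (n - i != n - j)%N by lia.
  move=> /(_ isT); rewrite /total_pull addrC.
  have -> : (n - i < n)%N = (0 < i)%N by lia.
  have -> : (0 < n - i)%N = (i < n)%N by lia.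
  have [i0|] := boolP (0 < i)%N.
    have -> : (n - i).+1 = (n - i.-1)%N by lia.
    case: (boolP (i < n)%N) => [inn|_] //.
    by have -> : (n - i).-1 = (n - i.+1)%N by lia.
  case: (boolP (i < n)%N) => [inn|_] //.
  by have -> : (n - i).-1 = (n - i.+1)%N by lia.
Qed.

Lemma taut_map (phi : plane -> plane) (e : R) : e ^+ 2 = 1 ->
  (forall a b c, orient (phi a) (phi b) (phi c) = e * orient a b c) ->
  (forall a b c, inner (phi a) (phi b) (phi c) = inner a b c) ->
  taut n (phi \o P).
Proof.
move=> e2 orE inE.
have e0 : e != 0 by apply/eqP => e0; move: e2; rewrite e0 expr0n => /eqP; rewrite eq_sym oner_eq0.
have e1 : e = 1 \/ e = -1.
  by move/eqP: e2; rewrite sqrf_eq1 => /orP[] /eqP; [left|right].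
split.
- move=> i j k l il jl kl ll /=; rewrite !orE.
  case: e1 => ->; first by rewrite !mul1r; exact: (taut_convex tP).
  rewrite !mulN1r -!orient_swap => h1 h2 h3.
  exact: (taut_convex tP _ _ _ _ h1 h3 h2).
- move=> i j k *; rewrite /= orE mulf_neq0 //.
  exact: (taut_noncollinear tP).
- move=> i j k *; rewrite /= !orE mulrACA -expr2 e2 mul1r.
  exact: (taut_side tP).
- move=> i j il jl ij.
  have E v x w : pull (phi v) (phi x) (phi w) = pull v x w.
    by rewrite /pull !edistE !inE.
  by rewrite /total_pull /= !E; exact: (taut_pull tP).
Qed.

End Invariance.

End Taut.

(** * A gap with a farthest vertex in between *)

Section Gap.
Variable R : realType.
Local Notation plane := (R * R)%type.
Implicit Types (P : nat -> plane).

(** All later vertices lie on one side of the link from P_i, hence within a half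
    plane seen from P_i, so one of them, P_g, is outermost; it minimizes the
    cotangent of the angle with the link.  The earlier vertices lie across the
    link, and an earlier vertex beyond the line P_g P_i would put P_i inside a
    triangle of vertices. *)
Lemma fan_extremal n P i : taut n P -> (i.+1 < n)%N ->
  (forall k, (i.+1 < k <= n)%N -> 0 < orient (P i) (P i.+1) (P k)) ->
  (forall k, (k < i)%N -> orient (P i) (P i.+1) (P k) < 0) ->
  exists2 g, (i.+1 < g <= n)%N &
    forall k, (k <= n)%N -> k != i -> k != g -> 0 < orient (P g) (P i) (P k).
Proof.
move=> tP iltn later earlier.
set A := P i; set T := P i.+1.
pose cotan k := inner A T (P k) / orient A T (P k).
have [g gin gmin] := argmax_nat (fun k => - cotan k) iltn.
exists g => // k kn ki kg.
have oG : 0 < orient A T (P g) by exact: later.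
have nz : orient (P g) A (P k) != 0.
  by apply: (taut_noncollinear tP) => //; idx_lia.
rewrite lt0r nz /=.
have [kearly|klate] := ltnP k i.
  rewrite leNgt; apply/negP => H.
  have oK : orient A T (P k) < 0 by exact: earlier.
  have [] := @taut_convex _ _ _ tP i.+1 g k i; try idx_lia.
  - by rewrite -orient_rot.
  - by rewrite orient_swap oppr_gt0 -orient_rot -orient_rot.
  - by rewrite -/A -/T orient_rot orient_swap oppr_gt0.
have [->|kT] := eqVneq k i.+1; first by rewrite orient_rot ltW.
have oK : 0 < orient A T (P k) by apply: later; idx_lia.
have : cotan g <= cotan k by rewrite -lerN2; apply: gmin; idx_lia.
rewrite /cotan ler_pdivlMr // mulrAC ler_pdivrMr // => H.
have dAT : 0 < inner A T T.
  rewrite -edist_sqr exprn_gt0 // edist_gt0 //; apply/eqP => E.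
  by move: oG; rewrite E /orient !subrr !mul0r subrr ltxx.
rewrite -(pmulr_rge0 _ dAT).
have -> : inner A T T * orient (P g) A (P k) =
  inner A T (P k) * orient A T (P g) - inner A T (P g) * orient A T (P k).
  by rewrite /inner /orient; ring.
by rewrite subr_ge0.
Qed.

(** The sign e tells on which side of the edge the path lies. *)
Definition edge_sided n P (e : R) (i j : nat) :=
  forall k, (k <= n)%N -> k != i -> k != j -> 0 < e * orient (P i) (P j) (P k).

Definition farthest n P (e : R) (i j m : nat) :=
  forall k, (k <= n)%N ->
    e * orient (P i) (P j) (P k) <= e * orient (P i) (P j) (P m).

(** The gaps run through by the search for one whose farthest vertex is visited
    between its ends: only m < j is still missing. *)
Definition late_gap n P (e : R) (i j m : nat) :=
  [/\ (i.+1 < j <= n)%N, (i < m <= n)%N, edge_sided n P e i j &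
      farthest n P e i j m].

Let mirror (x : plane) : plane := (x.1, - x.2).

Let orient_mirror a b c : orient (mirror a) (mirror b) (mirror c) =
  -1 * orient a b c.
Proof. by rewrite /orient /=; ring. Qed.

Let taut_mirror n P : taut n P -> taut n (mirror \o P).
Proof.
move=> tP; apply: (taut_map tP (e := -1)); first by ring.
  exact: orient_mirror.
by move=> a b c; rewrite /inner /=; ring.
Qed.

Let late_gap_mirror n P e i j m : late_gap n (mirror \o P) e i j m ->
  late_gap n P (- e) i j m.
Proof.
case=> h1 h2 h3 h4; split => // k.
  by move=> a b c; have := h3 k a b c; rewrite /= orient_mirror mulrA mulrN1.
by move=> a; have := h4 k a; rewrite /= !orient_mirror !mulrA mulrN1.
Qed.

(** Every other vertex is later than the first link, so that link is a hull edge,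
    and the outermost vertex seen from P_0 gives the other hull edge at P_0. *)
Lemma late_gap_start n P : taut n P -> (1 < n)%N ->
  exists (e : R) j m, [/\ e ^+ 2 = 1 & late_gap n P e 0 j m].
Proof.
move=> tP n1.
wlog pos : P tP / 0 < orient (P 0%N) (P 1%N) (P 2%N).
  move=> W; have := taut_noncollinear tP (leq0n n) (ltnW n1) n1 isT isT isT.
  rewrite neq_lt => /orP[neg|]; last exact: W.
  have [||e [j [m [e2 H]]]] := W (mirror \o P); first exact: taut_mirror.
    by rewrite orient_mirror mulN1r oppr_gt0.
  by exists (- e), j, m; split; [rewrite sqrrN|exact: late_gap_mirror].
have later k : (1 < k <= n)%N -> 0 < orient (P 0%N) (P 1%N) (P k).
  move=> kn; rewrite -(pmulr_rgt0 _ pos).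
  by apply: (taut_side tP); idx_lia.
have [//|g gn edge] := fan_extremal tP n1 later.
have [m /andP[_ mn] mmax] :=
  argmax_nat (fun k => orient (P g) (P 0%N) (P k)) (leq0n n).
have pos1 : 0 < orient (P g) (P 0%N) (P m).
  apply: lt_le_trans (mmax 1%N _); last by idx_lia.
  by apply: edge; idx_lia.
have m0 : (m != 0)%N.
  by apply/eqP => E; move: pos1; rewrite E orient_abb ltxx.
exists (-1), g, m; split; first by ring.
split; rewrite ?lt0n ?m0 //.
- by move=> k kn k0 kg; rewrite mulN1r -orient_swap edge.
- by move=> k kn; rewrite !mulN1r -!orient_swap mmax.
Qed.

(** The link that enters T = P_j from A cuts the hull; beyond it A and its
    outermost vertex G form the next gap.  A vertex beyond the cut that is
    farthest from F T forces the line A G to move away from F T, hence T is at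
    least as far from A G as every vertex on the near side of the cut. *)
Lemma late_gap_step n P i j m : taut n P -> late_gap n P 1 i j m ->
  (j < m)%N -> exists j' m', late_gap n P (-1) j.-1 j' m'.
Proof.
move=> tP [ijn imn edge far] jm.
have {}edge k : (k <= n)%N -> k != i -> k != j -> 0 < orient (P i) (P j) (P k).
  by move=> *; rewrite -[X in 0 < X]mul1r; exact: edge.
have {}far k : (k <= n)%N -> orient (P i) (P j) (P k) <= orient (P i) (P j) (P m).
  by move=> kn; have := far k kn; rewrite !mul1r.
case: j ijn edge far jm => [//|a] ijn edge far jm /=.
have oA : 0 < orient (P i) (P a.+1) (P a) by apply: edge; idx_lia.
have oY : 0 < orient (P i) (P a.+1) (P a.+2) by apply: edge; idx_lia.
have oYA : 0 < orient (P a) (P a.+1) (P a.+2).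
  have : 0 < orient (P a.+1) (P a.+2) (P i) * orient (P a.+1) (P a.+2) (P a).
    by apply: (taut_side tP); idx_lia.
  by rewrite -orient_rot pmulr_rgt0 // -orient_rot.
have later k : (a.+1 < k <= n)%N -> 0 < orient (P a) (P a.+1) (P k).
  move=> kn; rewrite -(pmulr_rgt0 _ oYA).
  by apply: (taut_side tP); idx_lia.
have earlier k : (k < a)%N -> orient (P a) (P a.+1) (P k) < 0.
  move=> kn.
  have : 0 < orient (P a) (P a.+1) (P i) * orient (P a) (P a.+1) (P k).
    by apply: (taut_side tP); idx_lia.
  have oi : orient (P a) (P a.+1) (P i) < 0.
    by rewrite orient_rot orient_swap oppr_lt0.
  by rewrite nmulr_rgt0.
have [|g gn gedge] := fan_extremal tP _ later earlier; first by idx_lia.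
set F := P i in oA oY *; set T := P a.+1 in oA oY oYA *.
set A := P a in oA oYA *; set G := P g.
have oG : 0 < orient A T G by apply: later.
(* The line A G does not approach the line F T on the far side of T. *)
have rising : 0 <= orient F T G - orient F T A.
  have oM : 0 < orient A T (P m) by apply: later; idx_lia.
  have oGM : 0 <= orient G A (P m).
    have [->|mg] := eqVneq m g; last by apply/ltW/gedge; idx_lia.
    by rewrite orient_aba.
  have farA : orient F T A <= orient F T (P m) by apply: far; idx_lia.
  rewrite -(pmulr_lge0 _ oM).
  have -> : (orient F T G - orient F T A) * orient A T (P m) =
    (orient F T (P m) - orient F T A) * orient A T G +
    orient F T A * orient G A (P m) by rewrite /orient; ring.
  apply: addr_ge0; apply: mulr_ge0; [by rewrite subr_ge0|exact: ltW|exact: ltW|by []].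
have oGT : 0 < orient G A T by rewrite orient_rot.
have beyond k : (k < a)%N -> orient G A (P k) <= orient G A T.
  move=> ka; rewrite -subr_ge0 -(pmulr_rge0 _ oA).
  have -> : orient F T A * (orient G A T - orient G A (P k)) =
    (orient F T G - orient F T A) * - orient A T (P k) +
    orient G A T * orient F T (P k) by rewrite /orient; ring.
  have oK : 0 <= orient F T (P k).
    have [->|ki] := eqVneq k i; first by rewrite orient_aba.
    by apply/ltW/edge; idx_lia.
  have := earlier k ka; rewrite -oppr_gt0 => oAT.
  by apply: addr_ge0; apply: mulr_ge0 => //; exact: ltW.
have an : (a.+1 <= n)%N by idx_lia.
have [m' m'n m'max] := argmax_nat (fun k => orient G A (P k)) an.
exists g, m'; split => //.
- by move=> k kn ka kg; rewrite mulN1r -orient_swap; exact: gedge.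
- move=> k kn; rewrite !mulN1r -!orient_swap -/A -/G.
  have [ka|ak|->] := ltngtP k a.
  + by apply: le_trans (beyond k ka) (m'max a.+1 _); idx_lia.
  + by apply: m'max; idx_lia.
  + apply: le_trans (m'max a.+1 _); last by idx_lia.
    by rewrite orient_abb ltW.
Qed.

(** Each step moves the start of the gap forward along the path. *)
Lemma middle_gap n P : taut n P -> (1 < n)%N ->
  exists (e : R) i j m, [/\ e ^+ 2 = 1, late_gap n P e i j m & (m < j)%N].
Proof.
move=> tP n1.
have [e [j [m [e2 H]]]] := late_gap_start tP n1.
suff main d i (f : R) j' m' : (n - i <= d)%N -> f ^+ 2 = 1 ->
    late_gap n P f i j' m' -> exists (e : R) i j m,
    [/\ e ^+ 2 = 1, late_gap n P e i j m & (m < j)%N].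
  exact: main (leqnn _) e2 H.
elim: d i f j' m' {e j m e2 H} => [|d IH] i e j m dn e2 gap.
  by case: gap; idx_lia.
have mj : m != j.
  apply/eqP => mj; case: gap => ijn imn edge far.
  have iin : (i.+1 <= n)%N by idx_lia.
  have := far _ iin; rewrite mj orient_abb mulr0 leNgt => /negP; apply.
  by apply: edge; idx_lia.
have [mltj|jltm|/eqP E] := ltngtP m j; last by rewrite E in mj.
  by exists e, i, j, m.
have [j' [m' gap']] : exists j' m', late_gap n P (- e) j.-1 j' m'.
  move/eqP: e2; rewrite sqrf_eq1 => /orP[]/eqP E; rewrite E in gap *.
    exact: late_gap_step gap jltm.
  have gap1 : late_gap n (mirror \o P) 1 i j m.
    case: gap => h1 h2 h3 h4; split => //.
      by move=> k a b c; have := h3 k a b c; rewrite /= orient_mirror mul1r.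
    by move=> k a; have := h4 k a; rewrite /= !orient_mirror !mul1r.
  have [j' [m' gap']] := late_gap_step (taut_mirror tP) gap1 jltm.
  by exists j', m'; exact: late_gap_mirror.
by apply: (IH j.-1 (- e) j' m'); rewrite ?sqrrN //; case: gap; idx_lia.
Qed.

(** Such a link separates the two ends of the path as well, so the segment that
    joins them crosses the interior of the hull: otherwise one of the ends of the
    link would be inside a triangle of vertices. *)
Lemma separating_link n P i k l e : taut n P -> (i < n)%N ->
  (k <= n)%N -> (l <= n)%N ->
  orient (P i) (P i.+1) (P k) < 0 < orient (P i) (P i.+1) (P l) ->
  e ^+ 2 = 1 -> edge_sided n P e 0 n -> False.
Proof.
move=> tP iln kn ln /andP[ok ol] e2 edge.
have ki : (k < i)%N || (i.+1 < k)%N.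
  move: ok; have [->|] := eqVneq k i; first by rewrite orient_aba ltxx.
  have [->|] := eqVneq k i.+1; first by rewrite orient_abb ltxx.
  by idx_lia.
have li : (l < i)%N || (i.+1 < l)%N.
  move: ol; have [->|] := eqVneq l i; first by rewrite orient_aba ltxx.
  have [->|] := eqVneq l i.+1; first by rewrite orient_abb ltxx.
  by idx_lia.
have opp : (k < i)%N = ~~ (l < i)%N.
  apply/idP/idP; move=> H.
    apply/negP => H'; have := taut_side tP iln kn ln; rewrite H H' => /(_ isT).
    by rewrite nmulr_rgt0 // ltNge ltW.
  apply/negP => /negP H'.
  have := taut_side tP iln kn ln.
  have -> : ((k < i) && (l < i) || (i.+1 < k) && (i.+1 < l))%N by idx_lia.
  by move=> /(_ isT); rewrite nmulr_rgt0 // ltNge ltW.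
have i0 : (0 < i)%N by idx_lia.
have in1 : (i.+1 < n)%N by idx_lia.
have n0 : (0 <= n)%N by [].
have tri a b c d := @taut_convex _ _ _ tP a b c d.
have ei : 0 < e * orient (P 0%N) (P n) (P i) by apply: edge; idx_lia.
have ei1 : 0 < e * orient (P 0%N) (P n) (P i.+1) by apply: edge; idx_lia.
set p := orient (P i) (P i.+1) (P 0%N); set q := orient (P i) (P i.+1) (P n).
have perm a : let o := orient (P i) (P i.+1) a in
    [/\ orient a (P i) (P i.+1) = o, orient (P i.+1) a (P i) = o,
       orient (P i) a (P i.+1) = - o & orient a (P i.+1) (P i) = - o].
  by rewrite /orient /=; split; ring.
have [p1 p2 p3 p4] := perm (P 0%N); have [q1 q2 q3 q4] := perm (P n).
rewrite -/p in p1 p2 p3 p4; rewrite -/q in q1 q2 q3 q4.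
have [[p0 q0]|[p0 q0]] : p < 0 /\ 0 < q \/ 0 < p /\ q < 0.
  have [[k0 l0]|[l0 k0]] : (k < i /\ i.+1 < l)%N \/ (l < i /\ i.+1 < k)%N by idx_lia.
    have := taut_side tP iln n0 kn; rewrite i0 k0 => /(_ isT).
    have := taut_side tP iln (leqnn n) ln; rewrite in1 l0 orbT => /(_ isT).
    by rewrite -/p -/q (pmulr_lgt0 _ ol) (nmulr_lgt0 _ ok) => *; left.
  have := taut_side tP iln n0 ln; rewrite i0 l0 => /(_ isT).
  have := taut_side tP iln (leqnn n) kn; rewrite in1 k0 orbT => /(_ isT).
  by rewrite -/p -/q (nmulr_lgt0 _ ok) (pmulr_lgt0 _ ol) => *; right.
all: move/eqP: e2 ei ei1; rewrite sqrf_eq1 => /orP[]/eqP ->;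
  rewrite ?mul1r ?mulN1r -?orient_swap => ei ei1.
- apply: (tri 0 n i i.+1 _ _ _ _ ei1)%N; rewrite ?q1 ?p3 ?oppr_gt0 //; idx_lia.
- apply: (tri n 0 i.+1 i _ _ _ _ ei)%N; rewrite ?q2 ?p4 ?oppr_gt0 //; idx_lia.
- apply: (tri 0 n i.+1 i _ _ _ _ ei)%N; rewrite ?q4 ?p2 ?oppr_gt0 //; idx_lia.
- apply: (tri n 0 i i.+1 _ _ _ _ ei1)%N; rewrite ?q3 ?p1 ?oppr_gt0 //; idx_lia.
Qed.

End Gap.

(** * Estimates around the end of a gap *)

Section Tail.
Variable R : realType.
Local Notation plane := (R * R)%type.
Implicit Types (P : nat -> plane) (a b x y z : plane).

Lemma sqrt2_sqr : Num.sqrt 2 ^+ 2 = 2 :> R.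
Proof. by rewrite sqr_sqrtr. Qed.

Lemma sqrt2_mul_le_edist a b (v : R) : 0 <= v -> v <= a.1 - b.1 ->
  v <= `|a.2 - b.2| -> Num.sqrt 2 * v <= edist a b.
Proof.
move=> v0 v1 v2.
rewrite -(ler_pXn2r (n := 2)) ?nnegrE ?edist_ge0 ?mulr_ge0 ?sqrtr_ge0 //.
rewrite edist_sqr exprMn sqrt2_sqr /inner.
have : v ^+ 2 <= `|a.2 - b.2| ^+ 2 by rewrite ler_pXn2r ?nnegrE.
have : v ^+ 2 <= (a.1 - b.1) ^+ 2 by rewrite ler_pXn2r ?nnegrE //; lra.
by rewrite real_normK ?num_real //; lra.
Qed.

Lemma height_le_edist a b : b.2 - a.2 <= edist a b.
Proof.
have [/le_trans-> //|pos] := lerP (b.2 - a.2) 0; first exact: edist_ge0.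
rewrite -(ler_pXn2r (n := 2)) ?nnegrE ?edist_ge0 ?(ltW pos) //.
by rewrite edist_sqr /inner -expr2 -(expr2 (b.2 - a.2)) lerDr sqr_ge0.
Qed.

(** The first-order condition at T, placed at the origin with the gap along the
    negative first axis: the angle of the incoming link and that of the outgoing
    link with the gap add up to at most pi. *)
Lemma pull_slope (a y : plane) : 0 < a.2 -> 0 < y.2 ->
  0 < a.2 * y.1 - a.1 * y.2 ->
  a.1 / edist 0 a + y.1 / edist 0 y <= 0 ->
  a.1 < 0 /\ a.2 * y.1 <= - a.1 * y.2.
Proof.
move=> a2 y2 cw.
have a0 : 0 < edist 0 a.
  by apply: edist_gt0; apply/eqP => E; rewrite -E ltxx in a2.
have y0 : 0 < edist 0 y.
  by apply: edist_gt0; apply/eqP => E; rewrite -E ltxx in y2.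
move=> pul.
have pul' : y.1 * edist 0 a <= - a.1 * edist 0 y.
  by rewrite -ler_pdivlMr // mulrAC -ler_pdivrMr //; lra.
have a1 : a.1 < 0.
  rewrite ltNge; apply/negP => a1.
  have y1 : y.1 <= 0.
    rewrite -(pmulr_lle0 _ a0); apply: le_trans pul' _.
    by rewrite mulNr oppr_le0 mulr_ge0 // ltW.
  nra.
split => //.
have [y1|y1] := lerP y.1 0; first by nra.
have sq : (y.1 * edist 0 a) ^+ 2 <= (- a.1 * edist 0 y) ^+ 2.
  rewrite ler_pXn2r ?nnegrE //; first by rewrite mulr_ge0 // ltW.
  by rewrite mulr_ge0 // ltW // oppr_gt0.
rewrite -(ler_pXn2r (n := 2)) ?nnegrE //; last 2 first.
- by rewrite mulr_ge0 // ltW.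
- by rewrite mulr_ge0 ?oppr_ge0 // ltW.
by move: sq; rewrite !exprMn !edist_sqr /inner /=; lra.
Qed.

(** With r = |a| and rho = |g|, the angle between a and g is at most the angle
    between a = (-p, q) and its mirror image (p, q), whose cosine is
    (q^2 - p^2) / r^2.  The angle at g in the triangle 0, a, g is not obtuse, so
    rho is at least the projection of a on g, that is (q^2 - p^2) / r at least.
    Then r + rho is at least 2 q^2 / r, and r is at most sqrt 2 * q. *)
Lemma steep_links_length (a g : plane) : 0 < - a.1 < a.2 -> 0 < g.2 ->
  0 < a.2 * g.1 - a.1 * g.2 -> a.2 * g.1 <= - a.1 * g.2 ->
  0 <= inner g 0 a ->
  Num.sqrt 2 * a.2 <= edist a 0 + edist 0 g.
Proof.
set p := - a.1; set q := a.2 => /andP[p0 pq] g2 cw ccw obtuse.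
have a1E : a.1 = - p by rewrite opprK.
set r := edist a 0; set rho := edist 0 g.
have q0 : 0 < q by exact: lt_trans pq.
have rr : r ^+ 2 = p ^+ 2 + q ^+ 2.
  by rewrite /r edist_sqr /inner /= /p /q; ring.
have rhorho : rho ^+ 2 = g.1 ^+ 2 + g.2 ^+ 2.
  by rewrite /rho edist_sqr /inner /=; ring.
have r0 : 0 < r.
  by apply: edist_gt0; apply/eqP => E; rewrite /q E ltxx in q0.
have rho0 : 0 < rho.
  by apply: edist_gt0; apply/eqP => E; rewrite -E ltxx in g2.
pose u := p * g.2 - q * g.1; pose w := p * g.2 + q * g.1.
have u0 : 0 <= u by rewrite subr_ge0.
have w0 : 0 < w by move: cw; rewrite a1E /w; lra.
have dot : - p * g.1 + q * g.2 <= rho ^+ 2.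
  by move: obtuse; rewrite rhorho /inner a1E -/q /=; lra.
have dotE : 2 * p * q * (- p * g.1 + q * g.2) = u * r ^+ 2 + w * (q ^+ 2 - p ^+ 2).
  by rewrite rr /u /w; ring.
have q2p2 : 0 < q ^+ 2 - p ^+ 2 by nra.
have rho_le : 2 * p * q * rho <= (u + w) * r.
  rewrite -(ler_pXn2r (n := 2)) ?nnegrE ?mulr_ge0 ?(ltW p0) ?(ltW q0) ?(ltW r0) ?(ltW rho0) //; last by lra.
  rewrite !exprMn rr rhorho -subr_ge0.
  have -> : (u + w) ^+ 2 * (p ^+ 2 + q ^+ 2) - 2 ^+ 2 * p ^+ 2 * q ^+ 2 * (g.1 ^+ 2 + g.2 ^+ 2) =
    4 * p ^+ 2 * (u * w) by rewrite /u /w; ring.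
  by rewrite !mulr_ge0 ?sqr_ge0 // ltW.
have key : q ^+ 2 - p ^+ 2 <= r * rho.
  have pq0 : 0 < 2 * p * q by rewrite !mulr_gt0.
  rewrite -(ler_pM2r (mulr_gt0 pq0 rho0)).
  have h1 : (q ^+ 2 - p ^+ 2) * (2 * p * q * rho) <= (q ^+ 2 - p ^+ 2) * ((u + w) * r).
    by rewrite ler_pM2l.
  have h2 : 2 * p * q * (- p * g.1 + q * g.2) <= 2 * p * q * rho ^+ 2 by rewrite ler_pM2l.
  have h3 : r * (u * r ^+ 2 + w * (q ^+ 2 - p ^+ 2)) <= r * (2 * p * q * rho ^+ 2).
    by rewrite ler_pM2l // -dotE.
  (* The difference between r^2 and q^2 - p^2 is 2 p^2. *)
  have h4 : 0 <= r * u * (2 * p ^+ 2).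
    apply: mulr_ge0; last by rewrite mulr_ge0 ?sqr_ge0.
    by apply: mulr_ge0 => //; exact: ltW.
  by move: h3; rewrite rr; lra.
have s2 := sqrt2_sqr.
have s0 : 0 <= Num.sqrt 2 :> R by exact: sqrtr_ge0.
have rq : r <= Num.sqrt 2 * q.
  rewrite -(ler_pXn2r (n := 2)) ?nnegrE ?mulr_ge0 ?(ltW q0) ?(ltW r0) //.
  by rewrite exprMn s2 rr; lra.
rewrite -(ler_pM2l r0).
have : r * (Num.sqrt 2 * q) <= Num.sqrt 2 * q * (Num.sqrt 2 * q).
  by rewrite ler_wpM2r // mulr_ge0 // ltW.
have -> : Num.sqrt 2 * q * (Num.sqrt 2 * q) = 2 * q ^+ 2 by rewrite -{3}s2; ring.
by move: rr key; lra.
Qed.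

(** The direction of g is at least as steep as (p, q), and the angle at g in the
    triangle 0, a, g is not obtuse.  So, if g is below a, the line from g to a
    rises to the left with slope at most p / q < 1, and m is not above it.  If g
    is not below a, the positions of m relative to the lines 0 a and g a exclude
    that m is higher than a. *)
Lemma descent_slope (a g m : plane) : 0 < - a.1 < a.2 -> 0 < g.2 ->
  0 < a.2 * g.1 - a.1 * g.2 -> a.2 * g.1 <= - a.1 * g.2 ->
  0 <= inner g 0 a -> a.2 <= m.2 ->
  a.2 * m.1 - a.1 * m.2 <= 0 -> 0 <= orient g a m ->
  m.2 - a.2 <= a.1 - m.1.
Proof.
set p := - a.1; set q := a.2; set v := m.2 - q; set d := a.1 - m.1.
have a1E : a.1 = - p by rewrite opprK.
have m1E : m.1 = - p - d by rewrite /d a1E; ring.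
have m2E : m.2 = q + v by rewrite /v; ring.
rewrite /inner /orient m1E m2E -/q a1E /= => /andP[p0 pq] g2 cw ccw obtuse v0' left above.
have {v0'}v0 : 0 <= v by lra.
have q0 : 0 < q by exact: lt_trans pq.
pose wx := g.1 + p; pose wy := q - g.2.
have ob : g.2 * wy <= g.1 * wx by rewrite /wx /wy; lra.
have ab : wx * v <= wy * d by rewrite /wx /wy; lra.
have dv : p * v <= q * d by lra.
have [wy0|wy0] := ltP 0 wy.
  have wxy : wy <= wx.
    have [g1|g1] := ltP 0 g.1.
      have : g.1 <= g.2 by nra.
      by move=> g12; rewrite -(ler_pM2l g1); apply: le_trans ob; rewrite ler_pM2r.
    exfalso.
    have pos : 0 < g.2 * wy by rewrite mulr_gt0.
    have wxneg : wx < 0 by nra.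
    move: wy0 wxneg; rewrite /wx /wy => wy0 wxneg; nra.
  rewrite -(ler_pM2l wy0); apply: le_trans ab; rewrite ler_wpM2r //.
have [v00|vpos] := eqVneq v 0; first by rewrite v00 in dv *; nra.
have {vpos}vpos : 0 < v by rewrite lt0r vpos.
exfalso.
have h1 : q * (wx * v) <= q * (wy * d) by rewrite ler_pM2l.
have h2 : wy * (q * d) <= wy * (p * v) by rewrite ler_wnM2l.
have : q * wx <= wy * p by rewrite -(ler_pM2r vpos); lra.
by rewrite /wx /wy; lra.
Qed.

End Tail.

(** * Length of the path beyond a farthest vertex *)

Section Length.
Variable R : realType.
Local Notation plane := (R * R)%type.
Implicit Types (P Q : nat -> plane) (x y z : plane) (a g : nat).

Lemma orient_neq x y z : orient x y z != 0 -> [/\ x != y, y != z & x != z].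
Proof.
by move=> H; split; apply: contraNneq H => ->;
  rewrite ?orient_abb ?orient_aba // orient_rot orient_aba.
Qed.

Lemma orient_inner w x y z :
  orient w y z * inner w x x = inner w y x * orient w x z - orient w x y * inner w z x.
Proof. by rewrite /orient /inner; ring. Qed.

(** The vertices met between T = P_(a+1) and the outermost one P_g lie beyond the
    chord from T to P_g, or they would be inside the triangle that this chord
    forms with P_a. *)
Lemma fan_beyond n P a g k : taut n P -> (a.+1 < g <= n)%N ->
  (forall k, (a.+1 < k <= n)%N -> 0 < orient (P a) (P a.+1) (P k)) ->
  (forall k, (k <= n)%N -> k != a -> k != g -> 0 < orient (P g) (P a) (P k)) ->
  (a.+1 < k <= n)%N -> k != g -> 0 < orient (P g) (P a.+1) (P k).
Proof.
move=> tP gn later fan kn kg.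
have nz : orient (P g) (P a.+1) (P k) != 0.
  by apply: (taut_noncollinear tP); idx_lia.
rewrite lt0r nz /= leNgt; apply/negP => neg.
apply: (@taut_convex _ _ _ tP a a.+1 g k); try idx_lia.
- exact: later.
- by rewrite orient_swap oppr_gt0.
- by apply: fan; idx_lia.
Qed.

(** The first-order condition at G = P_g bounds the angle at G between A = P_a
    and the predecessor Y of G, because the link that leaves G cannot separate Y
    from A: it makes a larger angle with G A than G Y does, so if the latter were
    obtuse, both would be.  By [fan_beyond] the angle A G T is at most A G Y. *)
Lemma fan_acute n P a g : taut n P -> (a.+1 < g <= n)%N ->
  (forall k, (a.+1 < k <= n)%N -> 0 < orient (P a) (P a.+1) (P k)) ->
  (forall k, (k <= n)%N -> k != a -> k != g -> 0 < orient (P g) (P a) (P k)) ->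
  0 <= inner (P g) (P a.+1) (P a).
Proof.
move=> tP gn later fan.
have beyond k := @fan_beyond n P a g k tP gn later fan.
case: g gn fan beyond => [|y] gn fan beyond; first by idx_lia.
have oT : 0 < orient (P y.+1) (P a) (P a.+1) by apply: fan; idx_lia.
have oY : 0 < orient (P y.+1) (P a) (P y) by apply: fan; idx_lia.
have [GA _ GY] := orient_neq (lt0r_neq0 oY).
have GA2 : 0 < inner (P y.+1) (P a) (P a).
  by rewrite -edist_sqr exprn_gt0 // edist_gt0.
have acuteY : 0 <= inner (P y.+1) (P y) (P a).
  rewrite leNgt; apply/negP => obtuse.
  have pullY : pull (P y.+1) (P y) (P a) < 0.
    by rewrite /pull pmulr_llt0 // invr_gt0 edist_gt0.
  have := @taut_pull _ _ _ tP y.+1 a; rewrite /total_pull /=.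
  case: (ltnP y.+1 n) => [yn|_] pul; last first.
    by move: (pul ltac:(idx_lia) ltac:(idx_lia) ltac:(idx_lia)); rewrite addr0 leNgt pullY.
  have : 0 < pull (P y.+1) (P y.+2) (P a).
    by move: (pul ltac:(idx_lia) ltac:(idx_lia) ltac:(idx_lia)); lra.
  have oZ : 0 < orient (P y.+1) (P a) (P y.+2) by apply: fan; idx_lia.
  have [_ _ GZ] := orient_neq (lt0r_neq0 oZ).
  rewrite /pull pmulr_lgt0 ?invr_gt0 ?edist_gt0 // => acuteZ.
  have : 0 < orient (P y.+1) (P y.+2) (P a) * orient (P y.+1) (P y.+2) (P y).
    by apply: (taut_side tP); idx_lia.
  have -> : orient (P y.+1) (P y.+2) (P a) = - orient (P y.+1) (P a) (P y.+2).
    by rewrite /orient; ring.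
  have -> : orient (P y.+1) (P y.+2) (P y) = - orient (P y.+1) (P y) (P y.+2).
    by rewrite /orient; ring.
  rewrite mulrNN pmulr_rgt0 // => oYZ.
  have := orient_inner (P y.+1) (P a) (P y) (P y.+2).
  have : 0 < orient (P y.+1) (P y) (P y.+2) * inner (P y.+1) (P a) (P a).
    by rewrite mulr_gt0.
  have : inner (P y.+1) (P y) (P a) * orient (P y.+1) (P a) (P y.+2) < 0.
    by rewrite pmulr_llt0.
  have : 0 < orient (P y.+1) (P a) (P y) * inner (P y.+1) (P y.+2) (P a).
    by rewrite mulr_gt0.
  lra.
have [E|ya] := eqVneq y a.+1; first by rewrite -E.
have oTY : 0 < orient (P y.+1) (P a.+1) (P y) by apply: beyond; idx_lia.
have := orient_inner (P y.+1) (P a) (P a.+1) (P y).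
have : 0 < orient (P y.+1) (P a.+1) (P y) * inner (P y.+1) (P a) (P a).
  by rewrite mulr_gt0.
have : 0 <= orient (P y.+1) (P a) (P a.+1) * inner (P y.+1) (P y) (P a).
  by rewrite mulr_ge0 // ltW.
move=> h1 h2 h3; rewrite -(pmulr_lge0 _ oY); lra.
Qed.

(** Here T is the origin and the gap lies along the negative first axis.  The
    summit M is on the left of the line from T through its predecessor A.  So if
    T A is not steeper than the diagonal, M is seen from T under an angle of at
    most pi / 4; otherwise the descent from M to A and the broken line A T G are
    estimated separately. *)
Lemma tail_length n Q i a m : taut n Q -> (i < m <= a)%N -> (a.+1 < n)%N ->
  Q a.+1 = 0 -> (Q i).1 < 0 -> (Q i).2 = 0 ->
  (forall k, (k <= n)%N -> k != i -> k != a.+1 -> 0 < (Q k).2) ->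
  (forall k, (k <= n)%N -> (Q k).2 <= (Q m).2) ->
  Num.sqrt 2 * (Q m).2 <= \sum_(m <= k < n) edist (Q k) (Q k.+1).
Proof.
move=> tQ ima an QT QF1 QF2 above top.
set h := (Q m).2.
have h0 : 0 < h by apply: above; idx_lia.
have A2 : 0 < (Q a).2 by apply: above; idx_lia.
have Y2 : 0 < (Q a.+2).2 by apply: above; idx_lia.
have oTYA : 0 < orient (Q a.+1) (Q a.+2) (Q a).
  have : 0 < orient (Q a.+1) (Q a.+2) (Q i) * orient (Q a.+1) (Q a.+2) (Q a).
    by apply: (taut_side tQ); idx_lia.
  by rewrite pmulr_rgt0 // QT /orient QF2 /=; nra.
have oATY : 0 < orient (Q a) (Q a.+1) (Q a.+2) by rewrite orient_rot.
have later k : (a.+1 < k <= n)%N -> 0 < orient (Q a) (Q a.+1) (Q k).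
  move=> kn; rewrite -(pmulr_rgt0 _ oATY).
  by apply: (taut_side tQ); idx_lia.
have earlier k : (k < a)%N -> orient (Q a) (Q a.+1) (Q k) < 0.
  move=> kn.
  have : 0 < orient (Q a) (Q a.+1) (Q i) * orient (Q a) (Q a.+1) (Q k).
    by apply: (taut_side tQ); idx_lia.
  have oi : orient (Q a) (Q a.+1) (Q i) < 0.
    by rewrite QT /orient QF2 /=; nra.
  by rewrite nmulr_rgt0.
have [A1 slope] : (Q a).1 < 0 /\ (Q a).2 * (Q a.+2).1 <= - (Q a).1 * (Q a.+2).2.
  apply: pull_slope => //; first by move: oTYA; rewrite QT /orient /=; lra.
  have := @taut_pull _ _ _ tQ a.+1 i; rewrite /total_pull an /= QT.
  move=> /(_ ltac:(idx_lia) ltac:(idx_lia) ltac:(idx_lia)).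
  rewrite /pull /inner QF2 /= !subr0 !mulr0 !addr0 mulrAC [X in _ + X]mulrAC -mulrDl.
  by rewrite nmulr_lge0.
have oM : (Q a).2 * (Q m).1 - (Q a).1 * (Q m).2 <= 0.
  have [->|ma] := eqVneq m a; first by lra.
  have := earlier m ltac:(idx_lia); rewrite QT /orient /=; lra.
have topA : (Q a).2 <= h by apply: top; idx_lia.
have [flat|steep] := lerP (Q a).2 (- (Q a).1).
  apply: (@le_trans _ _ (edist (Q m) (Q a.+1))).
    rewrite edistC; apply: sqrt2_mul_le_edist; rewrite ?QT /=; first exact: ltW.
      by rewrite sub0r -/h; nra.
    by rewrite sub0r normrN ler_norm.
  apply: le_trans (edist_le_path Q (_ : m <= a.+1)%N) _; first by idx_lia.
  rewrite [X in _ <= X](@big_cat_nat _ _ _ a.+1) //=; try idx_lia.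
  by rewrite lerDl path_length_ge0.
have [|g gn fan] := fan_extremal tQ _ later earlier; first by idx_lia.
have acute := fan_acute tQ gn later fan.
have G2 : 0 < (Q g).2 by apply: above; idx_lia.
have cw : 0 < (Q a).2 * (Q g).1 - (Q a).1 * (Q g).2.
  by have := later g gn; rewrite QT /orient /=; lra.
have ccw : (Q a).2 * (Q g).1 <= - (Q a).1 * (Q g).2.
  have [<- //|gY] := eqVneq a.+2 g.
  have := fan_beyond tQ gn later fan (k := a.+2) ltac:(idx_lia) gY.
  rewrite QT /orient /= => o.
  have {}o : (Q a.+2).2 * (Q g).1 < (Q a.+2).1 * (Q g).2 by lra.
  rewrite -(ler_pM2r Y2).
  have : (Q a).2 * ((Q a.+2).2 * (Q g).1) <= (Q a).2 * ((Q a.+2).1 * (Q g).2).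
    by rewrite ler_pM2l // ltW.
  have : (Q a).2 * (Q a.+2).1 * (Q g).2 <= - (Q a).1 * (Q a.+2).2 * (Q g).2.
    by rewrite ler_pM2r.
  lra.
have steepA : 0 < - (Q a).1 < (Q a).2 by rewrite steep oppr_gt0 A1.
rewrite QT in acute.
have oGM : 0 <= orient (Q g) (Q a) (Q m).
  have [->|ma] := eqVneq m a; first by rewrite orient_abb.
  by apply/ltW/fan; idx_lia.
have d1 := descent_slope steepA G2 cw ccw acute topA oM oGM.
have d2 := steep_links_length steepA G2 cw ccw acute.
have d3 : Num.sqrt 2 * (h - (Q a).2) <= edist (Q a) (Q m).
  apply: sqrt2_mul_le_edist => //; first by lra.
  by rewrite distrC ler_norm.
have p1 : edist (Q a) (Q m) <= \sum_(m <= k < a) edist (Q k) (Q k.+1).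
  by rewrite edistC; apply: edist_le_path; idx_lia.
have p2 : edist 0 (Q g) <= \sum_(a.+1 <= k < g) edist (Q k) (Q k.+1).
  by rewrite -QT; apply: edist_le_path; idx_lia.
rewrite (@big_cat_nat _ _ _ a) //=; try idx_lia.
rewrite (@big_ltn _ _ _ a) /=; last by idx_lia.
rewrite (@big_cat_nat _ _ _ g a.+1) //=; try idx_lia.
have p3 := path_length_ge0 Q g n.
rewrite QT; lra.
Qed.

End Length.

(** * The length bound for a taut path *)

Section Frame.
Variable R : realType.
Local Notation plane := (R * R)%type.
Implicit Types (P Q : nat -> plane) (w x y z : plane) (e : R).

(** Orthonormal coordinates with origin o and first axis w; the sign e orients
    the second axis. *)
Definition frame o w e x : plane :=
  (w.1 * (x.1 - o.1) + w.2 * (x.2 - o.2),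
   e * (w.1 * (x.2 - o.2) - w.2 * (x.1 - o.1))).

Lemma frame_orient o w e x y z : dotp w w = 1 ->
  orient (frame o w e x) (frame o w e y) (frame o w e z) = e * orient x y z.
Proof.
rewrite /dotp => w1; rewrite -[RHS]mul1r -w1 /orient /frame /=; ring.
Qed.

Lemma frame_inner o w e x y z : dotp w w = 1 -> e ^+ 2 = 1 ->
  inner (frame o w e x) (frame o w e y) (frame o w e z) = inner x y z.
Proof.
rewrite /dotp => w1 e2; rewrite -[RHS]mul1r -w1 /inner /frame /=.
set u := w.1 * (y.2 - o.2) - w.2 * (y.1 - o.1).
have E s t : (e * s) * (e * t) = s * t by rewrite mulrACA -expr2 e2 mul1r.
by rewrite -!mulrBr E /u; ring.
Qed.

Lemma frame_edist o w e x y : dotp w w = 1 -> e ^+ 2 = 1 ->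
  edist (frame o w e x) (frame o w e y) = edist x y.
Proof. by move=> w1 e2; rewrite !edistE frame_inner. Qed.

Definition direction x y : plane :=
  ((y.1 - x.1) / edist x y, (y.2 - x.2) / edist x y).

Lemma direction_unit x y : x != y -> dotp (direction x y) (direction x y) = 1.
Proof.
move=> xy; have d0 := edist_gt0 xy.
have dn0 : edist x y != 0 by rewrite gt_eqF.
have := edist_sqr x y; rewrite /inner => d.
have -> : dotp (direction x y) (direction x y) = ((y.1 - x.1) * (y.1 - x.1) +
    (y.2 - x.2) * (y.2 - x.2)) / edist x y ^+ 2 by rewrite /dotp /=; field.
by rewrite -d divff // expf_neq0.
Qed.

Lemma frame_height x y e z :
  (frame y (direction x y) e z).2 = e * orient x y z / edist x y.
Proof. by rewrite /frame /direction /orient /=; ring. Qed.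

Lemma frame_first x y e : x != y ->
  (frame y (direction x y) e x).1 = - edist x y.
Proof.
move=> xy; have d0 := edist_gt0 xy.
have := edist_sqr x y; rewrite /frame /direction /inner /= => d.
apply: (mulfI (lt0r_neq0 d0)); rewrite mulrN -expr2 d.
by field; rewrite gt_eqF.
Qed.

Lemma gap_length_tail n P e i j m : taut n P -> e ^+ 2 = 1 ->
  (i < m < j)%N -> (j < n)%N -> edge_sided n P e i j -> farthest n P e i j m ->
  (1 + Num.sqrt 2) * (e * orient (P i) (P j) (P m)) <=
    edist (P i) (P j) * \sum_(0 <= k < n) edist (P k) (P k.+1).
Proof.
move=> tP e2 imj jn edge far.
have om : 0 < e * orient (P i) (P j) (P m) by apply: edge; idx_lia.
have FT : P i != P j.
  have : orient (P i) (P j) (P m) != 0.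
    by apply: contraTneq om => ->; rewrite mulr0 ltxx.
  by case/orient_neq.
have b0 := edist_gt0 FT.
set w := direction (P i) (P j); have w1 : dotp w w = 1 by exact: direction_unit.
pose Q := frame (P j) w e \o P.
have tQ : taut n Q.
  apply: (taut_map tP e2) => x y z; first exact: frame_orient.
  exact: frame_inner.
have Q2 k : (Q k).2 = e * orient (P i) (P j) (P k) / edist (P i) (P j).
  exact: frame_height.
have Qe k l : edist (Q k) (Q l) = edist (P k) (P l) by exact: frame_edist.
case: j => [|a] in jn imj edge far om FT b0 w w1 Q tQ Q2 Qe *; first by idx_lia.
have QT : Q a.+1 = 0 by rewrite /Q /= /frame !subrr !mulr0 subrr addr0 mulr0.
have QF1 : (Q i).1 < 0 by rewrite [X in X < _](frame_first e FT) oppr_lt0.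
have QF2 : (Q i).2 = 0 by rewrite Q2 orient_aba mulr0 mul0r.
have tail := @tail_length _ n Q i a m tQ ltac:(idx_lia) jn QT QF1 QF2.
have {}tail : Num.sqrt 2 * (Q m).2 <= \sum_(m <= k < n) edist (P k) (P k.+1).
  rewrite [X in _ <= X](eq_bigr (fun k => edist (Q k) (Q k.+1))); last by [].
  apply: tail => k kn; rewrite !Q2.
    by move=> ki ka; rewrite divr_gt0 // edge.
  by rewrite ler_pM2r ?invr_gt0 // far.
have rise : (Q m).2 <= \sum_(i <= k < m) edist (P k) (P k.+1).
  apply: le_trans (edist_le_path P (_ : i <= m)%N); last by idx_lia.
  by rewrite -Qe; have := height_le_edist (Q i) (Q m); rewrite QF2 subr0.
have start := path_length_ge0 P 0 i.
have -> : (1 + Num.sqrt 2) * (e * orient (P i) (P a.+1) (P m)) =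
    edist (P i) (P a.+1) * ((1 + Num.sqrt 2) * (Q m).2).
  by rewrite Q2; field; rewrite gt_eqF.
rewrite ler_pM2l //; move: (Q m).2 tail rise => h tail rise.
rewrite (@big_cat_nat _ _ _ m) //=; try idx_lia.
rewrite (@big_cat_nat _ _ _ i 0 m) //=; try idx_lia.
lra.
Qed.

(** If the later end of the gap is the end of the path, the reversed path applies:
    it starts there and continues beyond the other end of the gap. *)
Lemma gap_length n P e i j m : taut n P -> e ^+ 2 = 1 ->
  (i < m < j)%N -> (j <= n)%N -> ((0 < i) || (j < n))%N ->
  edge_sided n P e i j -> farthest n P e i j m ->
  (1 + Num.sqrt 2) * (e * orient (P i) (P j) (P m)) <=
    edist (P i) (P j) * \sum_(0 <= k < n) edist (P k) (P k.+1).
Proof.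
move=> tP e2 imj jn /orP[i0|jltn] edge far; last exact: gap_length_tail.
pose P' k := P (n - k)%N.
have P'E k : (k <= n)%N -> P' (n - k)%N = P k by move=> kn; rewrite /P' subKn.
have flip k : (k <= n)%N ->
    - e * orient (P' (n - j)%N) (P' (n - i)%N) (P k) = e * orient (P i) (P j) (P k).
  by move=> kn; rewrite !P'E ?[orient (P i) _ _]orient_swap ?mulNr ?mulrN //; idx_lia.
have := @gap_length_tail n P' (- e) (n - j) (n - i) (n - m) (taut_rev tP).
rewrite sqrrN [P' (n - m)%N]P'E ?flip; try idx_lia.
rewrite ![P' (n - _)%N]P'E; try idx_lia.
rewrite edistC big_nat_rev /= add0n.
rewrite (eq_big_nat _ _ (F2 := fun k => edist (P k) (P k.+1))); last first.
  move=> k kn; rewrite /P' edistC.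
  by congr (edist (P _) (P _)); idx_lia.
apply=> //; try idx_lia.
- move=> k kn ki kj; rewrite /P'.
  have := flip (n - k)%N ltac:(idx_lia); rewrite /P' => ->.
  by apply: edge; idx_lia.
- move=> k kn.
  by rewrite [P' k]/P' [P' (n - m)%N]P'E ?flip; try idx_lia; apply: far; idx_lia.
Qed.

Lemma taut_gap n P i k l : taut n P -> (i < n)%N -> (k <= n)%N -> (l <= n)%N ->
  orient (P i) (P i.+1) (P k) < 0 < orient (P i) (P i.+1) (P l) ->
  exists e i j m, [/\ e ^+ 2 = 1, (i < m < j)%N && (j <= n)%N,
    edge_sided n P e i j, farthest n P e i j m &
    (1 + Num.sqrt 2) * (e * orient (P i) (P j) (P m)) <=
    edist (P i) (P j) * \sum_(0 <= k < n) edist (P k) (P k.+1)].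
Proof.
move=> tP iltn kn ln sep.
have n1 : (1 < n)%N.
  rewrite ltnNge; apply/negP => n1.
  have E : n = 1%N /\ i = 0%N by idx_lia.
  have kE : k = 0%N \/ k = 1%N by idx_lia.
  move: sep; rewrite E.2 => /andP[+ _].
  by case: kE => ->; rewrite ?orient_aba ?orient_abb ltxx.
have [e [i' [j [m [e2 [ij im edge far] mj]]]]] := middle_gap tP n1.
exists e, i', j, m; split => //; first by idx_lia.
apply: gap_length => //; try idx_lia.
rewrite lt0n ltnNge -negb_and; apply/negP => /andP[/eqP i0 nj].
have jE : j = n by idx_lia.
by rewrite i0 jE in edge; exact: separating_link sep e2 edge.
Qed.

End Frame.

(** * Hulls, extreme points and escape paths *)

Section Hull.
Variable R : realType.
Local Notation plane := (R * R)%type.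
Implicit Types (x y z a b v w : plane) (A C : set plane) (p q : seq plane) (t : R).

Lemma plane_eq x y : x.1 = y.1 -> x.2 = y.2 -> x = y.
Proof. by case: x y => [x1 x2] [y1 y2] /= -> ->. Qed.

Definition segment_closed C :=
  forall x y t, 0 <= t <= 1 -> C x -> C y -> C (segment_point x y t).

Lemma convex_setE C : @convex_set R plane C <-> segment_closed C.
Proof.
split => [cC x y t /andP[t0 t1] Cx Cy|sC x y k /set_mem Cx /set_mem Cy].
  have := cC y x (Itv01 t0 t1); rewrite !inE => /(_ Cy Cx).
  by rewrite /conv /= addrC /segment_point.
apply/mem_set; rewrite /conv /= addrC.
by apply: sC; rewrite ?ge0 ?le1.
Qed.

Lemma hull_segment_closed A : segment_closed (hull A).
Proof.
move=> x y t t01 hx hy C CA; have /convex_setE cC := CA.1.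
exact: cC _ _ _ t01 (hx C CA) (hy C CA).
Qed.

Lemma sub_hull A : A `<=` hull A.
Proof. exact: sub_gen_smallest. Qed.

Lemma hull_sub A C : segment_closed C -> A `<=` C -> hull A `<=` C.
Proof. by move=> /convex_setE cC AC; exact: smallest_sub. Qed.

Lemma segment_point_0 x y : segment_point x y 0 = x.
Proof. by apply: plane_eq; rewrite /= /GRing.scale /=; ring. Qed.

Lemma segment_point_1 x y : segment_point x y 1 = y.
Proof. by apply: plane_eq; rewrite /= /GRing.scale /=; ring. Qed.

Lemma segment_closed_segment x y : segment_closed (segment x y).
Proof.
move=> _ _ t /andP[t0 t1] [r /andP[r0 r1] ->] [s /andP[s0 s1] ->].
exists ((1 - t) * r + t * s); first by apply/andP; split; nra.
by apply: plane_eq; rewrite /= /GRing.scale /=; ring.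
Qed.

Lemma interior_segment_closed C : segment_closed C -> segment_closed C°.
Proof.
move=> cC x y t t01 /nbhs_ballP[ex ex0 Cx] /nbhs_ballP[ey ey0 Cy].
apply/nbhs_ballP; exists (Num.min ex ey); first by rewrite /= lt_min ex0.
move=> z [z1 z2]; set d := z - segment_point x y t.
have -> : z = segment_point (x + d) (y + d) t.
  by apply: plane_eq; rewrite /d /= /GRing.scale /=; ring.
have small w e : Num.min ex ey <= e -> ball w e (w + d).
  move=> le; split; rewrite /ball /= opprD addrA subrr sub0r normrN.
    rewrite distrC; apply: lt_le_trans le; exact: z1.
  rewrite distrC; apply: lt_le_trans le; exact: z2.
by apply: cC => //; [apply/Cx/small|apply/Cy/small]; rewrite ge_min lexx ?orbT.
Qed.

Lemma path_image_vertex p i : (0 < links p)%N -> (i <= links p)%N ->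
  path_image p (vertex p i).
Proof.
move=> p0; rewrite leq_eqVlt => /predU1P[->|ip]; last first.
  by exists i => //; exists 0; rewrite ?lexx ?ler01 ?segment_point_0.
exists (links p).-1; first by rewrite prednK.
by exists 1; rewrite ?lexx ?ler01 // segment_point_1 prednK.
Qed.

Lemma path_hull_vertex p i : (0 < links p)%N -> (i <= links p)%N ->
  path_hull p (vertex p i).
Proof. by move=> p0 ip; apply: sub_hull; exact: path_image_vertex. Qed.

Lemma path_image_sub p C : segment_closed C ->
  (forall i, (i <= links p)%N -> C (vertex p i)) -> path_image p `<=` C.
Proof. by move=> cC Cv x [i ip [t t01 ->]]; apply: cC => //; apply: Cv; lia. Qed.

Lemma path_hull_sub p C : segment_closed C ->
  (forall i, (i <= links p)%N -> C (vertex p i)) -> path_hull p `<=` C.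
Proof. by move=> cC Cv; apply: hull_sub => //; exact: path_image_sub. Qed.

(** The points that a rigid motion sends into the interior of the triangle form a
    convex set, so a placement of q inside would carry p along. *)
Lemma escape_path_mono p q : escape_path p -> (1 < size q)%N ->
  (forall i, (i <= links p)%N -> path_hull q (vertex p i)) -> escape_path q.
Proof.
move=> [_ escp] q1 pq; split => // c s v cs sub.
apply: (escp c s v cs) => _ [x px <-].
pose C := [set x | (@K_triangle R)° (rigid_motion c s v x)].
have cC : segment_closed C.
  move=> y z t t01 Cy Cz; rewrite /C /=.
  have -> : rigid_motion c s v (segment_point y z t) =
    segment_point (rigid_motion c s v y) (rigid_motion c s v z) t.
    by apply: plane_eq; rewrite /= /GRing.scale /=; ring.
  by apply: interior_segment_closed => //; exact: hull_segment_closed.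
have qC : path_hull q `<=` C by apply: hull_sub => // y qy; apply: sub; exists y.
apply: (path_image_sub cC _ px) => i ip; apply: qC; exact: pq.
Qed.

(** Otherwise x or y would lie strictly inside a segment ending at z. *)
Lemma extreme_chord A x y z s : segment_closed A -> extreme_point A x ->
  extreme_point A y -> x != y -> A z -> z = segment_point x y s -> 0 <= s <= 1.
Proof.
move=> cA [Ax ex] [Ay ey] xy Az zE; apply/andP; split; rewrite leNgt;
  apply/negP => s0.
  have s1 : s - 1 < 0 by lra.
  have [||_ yx] := ex z y (s / (s - 1)) Az Ay.
  - apply/andP; split; first by rewrite nmulr_rgt0 ?invr_lt0.
    by rewrite ltr_ndivrMr // mul1r; lra.
  - by rewrite zE; apply: plane_eq; rewrite /= /GRing.scale /=; field; rewrite lt_eqF.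
  - by rewrite yx eqxx in xy.
have s1 : 0 < s by lra.
have [||xE _] := ey x z s^-1 Ax Az.
- by rewrite invr_gt0 s1 invf_lt1.
- by rewrite zE; apply: plane_eq; rewrite /= /GRing.scale /=; field; rewrite gt_eqF.
- by rewrite xE eqxx in xy.
Qed.

Lemma collinear_point x y z : x != y -> orient x y z = 0 ->
  exists s, z = segment_point x y s.
Proof.
move=> xy o; exists (inner x y z / inner x y y).
have nz : inner x y y != 0 by rewrite -edist_sqr expf_neq0 // gt_eqF // edist_gt0.
apply: plane_eq; rewrite /= /GRing.scale /=; apply: (mulIf nz).
  have -> : z.1 * inner x y y = x.1 * inner x y y + (y.1 - x.1) * inner x y z -
    (y.2 - x.2) * orient x y z by rewrite /inner /orient; ring.
  by rewrite o; field.
have -> : z.2 * inner x y y = x.2 * inner x y y + (y.2 - x.2) * inner x y z +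
  (y.1 - x.1) * orient x y z by rewrite /inner /orient; ring.
by rewrite o; field.
Qed.

Lemma extreme_noncollinear A x y z : segment_closed A -> extreme_point A x ->
  extreme_point A y -> extreme_point A z -> x != y -> y != z -> x != z ->
  orient x y z != 0.
Proof.
move=> cA ex ey ez xy yz xz; apply/eqP => o.
have [s zE] := collinear_point xy o.
have /andP[s0 s1] := extreme_chord cA ex ey xy ez.1 zE.
have sn0 : s != 0.
  by apply/eqP => sE; move: xz; rewrite zE sE segment_point_0 eqxx.
have sn1 : s != 1.
  by apply/eqP => sE; move: yz; rewrite zE sE segment_point_1 eqxx.
have [|xzE _] := ez.2 x y s ex.1 ey.1 _ zE.
  by rewrite !lt_neqAle eq_sym sn0 sn1 s0 s1.
by rewrite xzE eqxx in xz.
Qed.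

Lemma extreme_not_in_triangle A x y z v : segment_closed A ->
  A x -> A y -> A z -> extreme_point A v -> 0 < orient x y v ->
  0 < orient y z v -> 0 < orient z x v -> False.
Proof.
move=> cA Ax Ay Az [_ ev] o1 o2 o3.
set w := segment_point x y (orient z x v / (orient y z v + orient z x v)).
have d1 : 0 < orient y z v + orient z x v by rewrite addr_gt0.
have Aw : A w.
  apply: cA => //; rewrite divr_ge0 ?(ltW o3) ?(ltW d1) //=.
  by rewrite ler_pdivrMr // mul1r lerDr ltW.
have d2 : 0 < orient y z v + orient z x v + orient x y v by rewrite addr_gt0.
have [||_ zv] := ev w z (orient x y v / (orient y z v + orient z x v + orient x y v)) Aw Az.
- by rewrite divr_gt0 //= ltr_pdivrMr // mul1r ltrDr.
- rewrite /w; move: d1 d2; rewrite /orient => d1 d2.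
  by apply: plane_eq; rewrite /= /GRing.scale /=; field; rewrite !gt_eqF.
- by move: o2; rewrite zv orient_abb ltxx.
Qed.

End Hull.

(** * First variation of the length *)

Section Minimal.
Variable R : realType.
Local Notation plane := (R * R)%type.
Implicit Types (x y z a b v w : plane) (A C : set plane) (p q : seq plane) (t : R).

Lemma simple_link_neq p i : simple_path p -> (i < links p)%N ->
  vertex p i != vertex p i.+1.
Proof.
move=> sp ip; apply/eqP => E.
have h01 : 0 <= (0 : R) <= 1 by rewrite lexx ler01.
have h12 : 0 <= (2^-1 : R) <= 1 by apply/andP; split; lra.
have [| | |] := sp i i 0 2^-1 ip ip h01 h12.
- by apply: plane_eq; rewrite /link_point E /= /GRing.scale /=; ring.
- lra.
- move=> [i0 ie]; have : i%:R = 0 :> R by lra.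
  move=> i00; move: ie; rewrite i00 add0r => ie.
  have : (1 : R) <= (links p)%:R by rewrite ler1n; lia.
  by lra.
- move=> [i0 _]; have : (0 : R) <= i%:R by rewrite ler0n.
  by lra.
Qed.

Lemma lenE p : len p = \sum_(0 <= k < links p) edist (vertex p k) (vertex p k.+1).
Proof. by rewrite /len big_mkord. Qed.

(** Dropping the last link of a closed path changes neither its vertices nor its
    hull. *)
Lemma minimal_not_closed N p : simple_path p -> length_minimal N p ->
  closed_path p = false.
Proof.
move=> sp [ep pN pmin]; apply/negP => /eqP cl.
have n0 : (0 < links p)%N by move: ep.1; rewrite /links; case: (size p) => [|[]].
have n1 : (1 < links p)%N.
  rewrite ltn_neqAle n0 andbT; apply/eqP => E.
  by have := simple_link_neq sp n0; rewrite cl -E eqxx.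
pose q := take (links p) p.
have sq : size q = links p by rewrite size_take /links; case: (size p) n0 => //= m _; rewrite ltnSn.
have lq : links q = (links p).-1 by rewrite /links sq.
have vq k : (k < links p)%N -> vertex q k = vertex p k.
  by move=> kn; rewrite /vertex nth_take.
have eq : escape_path q.
  apply: (escape_path_mono ep) => [|i ip]; first by rewrite sq.
  have [->|il] := eqVneq i (links p).
    by rewrite -cl -vq //; apply: path_hull_vertex; lia.
  by rewrite -vq; [apply: path_hull_vertex|]; lia.
have := pmin q eq ltac:(lia); rewrite !lenE lq.
case: (links p) n0 n1 sq lq vq (simple_link_neq (i := (links p).-1) sp) => [//|n] _ _ _ _ vq nz.
have -> : \sum_(0 <= k < n) edist (vertex q k) (vertex q k.+1) =
          \sum_(0 <= k < n) edist (vertex p k) (vertex p k.+1).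
  by apply: eq_big_nat => k kn; rewrite !vq //; lia.
rewrite /= big_nat_recr //=.
by rewrite gerDl leNgt edist_gt0 // nz.
Qed.

Lemma sum_if_eq n i (b : R) :
  \sum_(0 <= k < n) (if k == i then b else 0) = if (i < n)%N then b else 0.
Proof.
elim: n => [|n IH]; first by rewrite big_geq.
rewrite big_nat_recr //= IH ltnS (eq_sym n).
by case: (ltngtP i n) => _; rewrite ?addr0 ?add0r.
Qed.

Lemma sum_neighbours n i (a b : R) : (i <= n)%N ->
  \sum_(0 <= k < n) ((if k.+1 == i then a else 0) + (if k == i then b else 0)) =
  (if (0 < i)%N then a else 0) + (if (i < n)%N then b else 0).
Proof.
move=> il; rewrite big_split /= sum_if_eq; congr (_ + _).
case: i il => [|i] il; first by rewrite big1.
by under eq_bigr do rewrite eqSS; rewrite sum_if_eq il.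
Qed.

Definition push v w (e : R) : plane := v + e *: (v - w).

(** The expansion of the distance up to second order, as a one-sided bound:
    a square root lies below its tangent. *)
Lemma push_edist v x w (e : R) : v != x ->
  edist (push v w e) x <=
  edist v x + e * pull v x w + e ^+ 2 * (inner v w w / (2 * edist v x)).
Proof.
move=> vx; have d0 := edist_gt0 vx.
set D := edist v x; set r := _ + _.
have rE : 2 * D * r = D ^+ 2 + inner (push v w e) x x.
  rewrite /r /pull.
  have -> : 2 * D * (D + e * (inner v x w / D) + e ^+ 2 * (inner v w w / (2 * D))) =
    2 * D ^+ 2 + 2 * e * inner v x w + e ^+ 2 * inner v w w.
    by field; rewrite gt_eqF.
  by rewrite edist_sqr /inner /push /= /GRing.scale /=; ring.
have i0 : 0 <= inner (push v w e) x x by rewrite -edist_sqr sqr_ge0.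
have r0 : 0 <= r.
  rewrite -(pmulr_rge0 _ (_ : 0 < 2 * D)); last by rewrite mulr_gt0.
  by rewrite rE addr_ge0 // sqr_ge0.
rewrite -(ler_pXn2r (n := 2)) ?nnegrE ?edist_ge0 // edist_sqr.
have : 0 <= (r - D) ^+ 2 by exact: sqr_ge0.
by rewrite sqrrB; move: rE; lra.
Qed.

(** A negative first variation would give a shorter path with a larger hull. *)
Lemma minimal_pull N p i j : (1 < size p)%N -> length_minimal N p ->
  (forall i, (i < links p)%N -> vertex p i != vertex p i.+1) ->
  (i <= links p)%N -> (j <= links p)%N -> i != j ->
  0 <= total_pull (links p) (vertex p) i (vertex p j).
Proof.
move=> p1 [ep pN pmin] nd il jl ij.
set n := links p; set P := vertex p; set V := P i; set W := P j.
rewrite leNgt; apply/negP => neg.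
pose c := inner V W W.
pose C := (if (0 < i)%N then c / (2 * edist V (P i.-1)) else 0) +
          (if (i < n)%N then c / (2 * edist V (P i.+1)) else 0).
have c0 : 0 <= c by rewrite /c -edist_sqr sqr_ge0.
have C0 : 0 <= C.
  by rewrite /C; apply: addr_ge0; case: ifP => // _; rewrite divr_ge0 // mulr_ge0 ?edist_ge0.
set T := total_pull _ _ _ _ in neg.
(* C bounds the second-order term; this e makes the first-order one win. *)
pose e := - T / (2 * (C + 1)).
have e0 : 0 < e by rewrite divr_gt0 // ?oppr_gt0 // mulr_gt0 //; lra.
have dec : e * T + e ^+ 2 * C < 0.
  have : e * (2 * (C + 1)) = - T by rewrite /e divfK // gt_eqF // mulr_gt0 //; lra.
  move=> eT; have -> : T = - (e * (2 * (C + 1))) by rewrite eT opprK.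
  have : 0 < e ^+ 2 * (C + 2) by rewrite mulr_gt0 // ?exprn_gt0 //; lra.
  lra.
pose q := set_nth 0 p i (push V W e).
have ip : (i < size p)%N by rewrite /n /links in il; lia.
have sq : size q = size p by rewrite size_set_nth; apply/maxn_idPr.
have lq : links q = n by rewrite /links sq.
have vqi : vertex q i = push V W e by rewrite /vertex nth_set_nth /= eqxx.
have vq k : k != i -> vertex q k = P k.
  by move=> ki; rewrite /vertex nth_set_nth /= (negbTE ki).
have n0 : (0 < n)%N by rewrite /n /links; lia.
have eq : escape_path q.
  apply: (escape_path_mono ep) => [|k kp]; first by rewrite sq.
  have [->|ki] := eqVneq k i; last by rewrite -/P -vq //; apply: path_hull_vertex; rewrite lq.
  have -> : vertex p i = segment_point (vertex q i) (vertex q j) (e / (1 + e)).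
    rewrite vqi vq 1?eq_sym // /push.
    by apply: plane_eq; rewrite -/P -/V -/W /= /GRing.scale /=; field; rewrite gt_eqF //; lra.
  apply: hull_segment_closed; try by apply: path_hull_vertex; rewrite lq.
  have e1 : 0 < 1 + e by lra.
  by rewrite divr_ge0 ?(ltW e0) ?(ltW e1) //= ler_pdivrMr // mul1r lerDr.
have := pmin q eq; rewrite lq => /(_ pN); rewrite leNgt => /negP; apply.
pose a1 := edist (push V W e) (P i.-1) - edist V (P i.-1).
pose a2 := edist (push V W e) (P i.+1) - edist V (P i.+1).
have lenq : len q = len p + ((if (0 < i)%N then a1 else 0) + (if (i < n)%N then a2 else 0)).
  rewrite !lenE lq -/n -(sum_neighbours a1 a2 il) -big_split.
  suff step k : (k < n)%N -> edist (vertex q k) (vertex q k.+1) =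
      edist (P k) (P k.+1) +
      ((if k.+1 == i then a1 else 0) + (if k == i then a2 else 0)).
    by apply: eq_big_nat => k /andP[_ kn]; exact: step.
  move=> kn.
  have [ki|ki] := eqVneq k i.
    have k1 : k.+1 == i = false by rewrite ki gtn_eqF.
    rewrite (vq k.+1) ?k1 // ki vqi add0r /a2 -/V; lra.
  have [ki1|ki1] := eqVneq k.+1 i.
    rewrite ki1 vqi (vq k) // /a1 -[k in P k]/(k.+1.-1) ki1 -/V.
    by rewrite (edistC (P i.-1)) (edistC (P i.-1)); lra.
  by rewrite !vq // !addr0.
rewrite lenq gtrDl.
apply: le_lt_trans dec; rewrite /T /total_pull /C -/n -/P -/V -/W.
have b1 : (0 < i)%N -> a1 <= e * pull V (P i.-1) W + e ^+ 2 * (c / (2 * edist V (P i.-1))).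
  move=> i0; have := @push_edist V (P i.-1) W e; rewrite /a1 /c.
  have := nd i.-1; rewrite prednK // eq_sym => /(_ il) -> /(_ isT); lra.
have b2 : (i < n)%N -> a2 <= e * pull V (P i.+1) W + e ^+ 2 * (c / (2 * edist V (P i.+1))).
  move=> i0; have := @push_edist V (P i.+1) W e; rewrite /a2 /c.
  by have := nd i i0 => -> /(_ isT); lra.
by case: ifP => [/b1|_]; case: ifP => [/b2|_]; lra.
Qed.

End Minimal.

(** * Minimal standard paths are taut *)

Section Assembly.
Variable R : realType.
Local Notation plane := (R * R)%type.
Implicit Types (x y z a b v w : plane) (A C : set plane) (p q : seq plane) (t : R).

(** A link whose ends are on opposite sides of the line through link i meets that
    line inside the hull, hence between the two extreme points that link i joins:
    the two links would cross. *)
Lemma simple_link_separates p i j : simple_path p -> (0 < links p)%N ->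
  (i < links p)%N -> (j < links p)%N -> (j.+1 < i)%N || (i.+1 < j)%N ->
  extreme_point (path_hull p) (vertex p i) ->
  extreme_point (path_hull p) (vertex p i.+1) ->
  vertex p i != vertex p i.+1 ->
  orient (vertex p i) (vertex p i.+1) (vertex p j) *
  orient (vertex p i) (vertex p i.+1) (vertex p j.+1) < 0 -> False.
Proof.
move=> sp n0 ip jp ij exi exi1 nd.
set X := vertex p i; set Y := vertex p i.+1.
set a := orient X Y _; set b := orient X Y _ => ab.
have d0 : a - b != 0.
  apply/eqP => d0; move: ab; have -> : a = b by lra.
  by rewrite -expr2 ltNge sqr_ge0.
pose t := a / (a - b).
have t01 : 0 < t < 1.
  have a0 : a != 0.
    by apply/eqP => a0; move: ab; rewrite a0 mul0r ltxx.
  have [an|ap] : a < 0 \/ 0 < a by apply/orP; rewrite -neq_lt.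
    have b0 : 0 < b by move: ab; rewrite nmulr_rlt0.
    have dn : a - b < 0 by lra.
    by rewrite /t nmulr_rgt0 // invr_lt0 dn ltr_ndivrMr // mul1r; lra.
  have b0 : b < 0 by move: ab; rewrite pmulr_rlt0.
  have dp : 0 < a - b by lra.
  by rewrite /t divr_gt0 //= ltr_pdivrMr // mul1r; lra.
have t01' : 0 <= t <= 1 by case/andP: t01 => ? ?; rewrite !ltW.
set Q := link_point p j t.
have oQ : orient X Y Q = 0.
  have -> : orient X Y Q = (1 - t) * a + t * b.
    by rewrite /a /b /orient /Q /= /GRing.scale /=; ring.
  by rewrite /t; field.
have [s QE] := collinear_point nd oQ.
have HQ : path_hull p Q.
  by apply: hull_segment_closed => //; apply: path_hull_vertex => //; exact: ltnW.
have s01 := extreme_chord (@hull_segment_closed _ _) exi exi1 nd HQ QE.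
have jn1 : j%:R + 1 <= (links p)%:R :> R by rewrite natr1 ler_nat.
have j0 : 0 <= j%:R :> R by rewrite ler0n.
have ijR : j%:R + 1 + 1 <= i%:R :> R \/ i%:R + 1 + 1 <= j%:R :> R.
  by case/orP: ij => H; [left|right]; rewrite !natr1 ler_nat.
case/andP: t01 => t0 t1; case/andP: s01 => s0 s1.
have s01 : 0 <= s <= 1 by rewrite s0.
have [E|[E _]|[_ E]] := sp j i t s jp ip t01' s01 QE.
- by case: ijR; lra.
- by lra.
- by lra.
Qed.

Lemma simple_side p i j k : simple_path p -> (i < links p)%N ->
  (forall l, (l <= links p)%N -> extreme_point (path_hull p) (vertex p l)) ->
  (forall l m, (l <= links p)%N -> (m <= links p)%N -> l != m ->
    vertex p l != vertex p m) ->
  (j <= k <= links p)%N -> (k < i)%N || (i.+1 < j)%N ->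
  0 < orient (vertex p i) (vertex p i.+1) (vertex p j) *
      orient (vertex p i) (vertex p i.+1) (vertex p k).
Proof.
move=> sp ip ext nd; set o := orient _ _.
have n0 : (0 < links p)%N by exact: leq_ltn_trans ip.
have onz l : (l <= links p)%N -> l != i -> l != i.+1 -> o (vertex p l) != 0.
  move=> lp li li1; apply: extreme_noncollinear (@hull_segment_closed _ _) _ _ _ _ _ _.
  - by apply: ext; exact: ltnW.
  - exact: ext.
  - exact: ext.
  - by apply: nd => //; [exact: ltnW|rewrite neq_ltn ltnSn].
  - by apply: nd; rewrite // eq_sym.
  - by apply: nd; rewrite // 1?eq_sym // ltnW.
have [d] := ubnP (k - j); elim: d k => // d IH k kd /andP[jk kp] out.
have [->|jnk] := eqVneq k j.
  rewrite -expr2 exprn_even_gt0 //=; apply: onz; [exact: leq_trans kp|lia|lia].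
case: k kd jk kp out jnk => [|k] kd jk kp out jnk; first by lia.
have posk : 0 < o (vertex p j) * o (vertex p k).
  by apply: IH; lia.
have step : 0 < o (vertex p k) * o (vertex p k.+1).
  rewrite lt0r mulf_neq0 ?onz //=; try lia.
  rewrite leNgt; apply/negP => H.
  apply: (@simple_link_separates p i k) => //; try lia.
  - by apply: ext; exact: ltnW.
  - exact: ext.
  - by apply: nd => //; [exact: ltnW|rewrite neq_ltn ltnSn].
have : 0 < o (vertex p k) ^+ 2 * (o (vertex p j) * o (vertex p k.+1)).
  have -> : o (vertex p k) ^+ 2 * (o (vertex p j) * o (vertex p k.+1)) =
    (o (vertex p j) * o (vertex p k)) * (o (vertex p k) * o (vertex p k.+1)) by ring.
  by rewrite mulr_gt0.
by rewrite pmulr_rgt0 // exprn_even_gt0 //=; apply: onz; lia.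
Qed.

Lemma standard_open_vertices p : standard p -> closed_path p = false ->
  [/\ uniq p, (0 < links p)%N,
    forall l, (l <= links p)%N -> extreme_point (path_hull p) (vertex p l) &
    forall l m, (l <= links p)%N -> (m <= links p)%N -> l != m ->
      vertex p l != vertex p m].
Proof.
case=> p1 _ + + cl; rewrite /nonrepeated_vertices cl => up ex.
have n0 : (0 < links p)%N by rewrite /links; case: (size p) p1 => [|[]].
have lt l : (l <= links p)%N -> (l < size p)%N.
  by rewrite /links; case: (size p) p1 => // n _.
split => // [l lp|l m lp mp lm].
  by rewrite -ex /=; apply: mem_nth; exact: lt.
by rewrite /vertex nth_uniq ?lt.
Qed.

Lemma minimal_taut N p : standard p -> length_minimal N p ->
  taut (links p) (vertex p).
Proof.
move=> stp minp.
have sp : simple_path p by case: stp.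
have cl := minimal_not_closed sp minp.
have [up n0 ext nd] := standard_open_vertices stp cl.
split.
- move=> i j k l ip jp kp lp.
  apply: extreme_not_in_triangle (@hull_segment_closed _ _) _ _ _ (ext l lp);
    exact: path_hull_vertex.
- move=> i j k ip jp kp ij jk ik.
  by apply: extreme_noncollinear (@hull_segment_closed _ _) (ext i ip) (ext j jp)
    (ext k kp) (nd _ _ _ _ ij) (nd _ _ _ _ jk) (nd _ _ _ _ ik).
- move=> i j k ip jp kp H.
  have [jk|/ltnW kj] := leqP j k.
    by apply: simple_side => //; [rewrite jk|lia].
  by rewrite mulrC; apply: simple_side => //; [rewrite kj|lia].
- move=> i j ip jp ij; apply: (minimal_pull _ minp) => //.
    by case: stp.
  by move=> k kp; apply: nd => //; [exact: ltnW|rewrite neq_ltn ltnSn].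
Qed.

End Assembly.

(** * Hull edges and support lines *)

Section Final.
Variable R : realType.
Local Notation plane := (R * R)%type.
Implicit Types (x y z a b v w o : plane) (A C : set plane) (p q : seq plane) (t e : R).

(** The sign e selects one of the two unit normals of the line x y. *)
Definition edge_normal x y e : plane :=
  (- (e * (direction x y).2), e * (direction x y).1).

Lemma edge_normal_unit x y e : x != y -> e ^+ 2 = 1 ->
  dotp (edge_normal x y e) (edge_normal x y e) = 1.
Proof.
move=> /direction_unit + e2; rewrite /dotp /edge_normal.
move: (direction x y) => w /= w1.
have -> : - (e * w.2) * - (e * w.2) + e * w.1 * (e * w.1) =
  e ^+ 2 * (w.1 * w.1 + w.2 * w.2) by ring.
by rewrite w1 e2 mul1r.
Qed.

Lemma edge_normal_height x y e z :
  dotp (edge_normal x y e) z - dotp (edge_normal x y e) y =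
  e * orient x y z / edist x y.
Proof. by rewrite -frame_height /dotp /edge_normal /frame /=; ring. Qed.

Definition edge_line x y e (h : R) : set plane :=
  line (edge_normal x y e) (dotp (edge_normal x y e) y + h).

Lemma edge_lineP x y e h z :
  edge_line x y e h z <-> e * orient x y z / edist x y = h.
Proof.
rewrite -edge_normal_height /edge_line /line /=; split; lra.
Qed.

(** The points of positive height form together with the segment a convex set,
    which contains all vertices, hence the hull. *)
Lemma one_sided_support p i j e : (i <= links p)%N -> (j <= links p)%N ->
  (0 < links p)%N -> vertex p i != vertex p j -> e ^+ 2 = 1 ->
  edge_sided (links p) (vertex p) e i j ->
  let L := edge_line (vertex p i) (vertex p j) e 0 in
  support_line (path_hull p) L /\
  L `&` path_hull p = segment (vertex p i) (vertex p j).
Proof.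
move=> ip jp n0 xy e2 edge L.
set x := vertex p i in xy L *; set y := vertex p j in xy L *.
have d0 := edist_gt0 xy.
pose hgt z := e * orient x y z / edist x y.
have hgt_seg z z' t : hgt (segment_point z z' t) = (1 - t) * hgt z + t * hgt z'.
  by rewrite /hgt /orient /= /GRing.scale /=; ring.
pose C := [set z | 0 <= hgt z /\ (hgt z = 0 -> segment x y z)].
have cC : segment_closed C.
  move=> z z' t /andP[t0 t1] [hz sz] [hz' sz']; split; rewrite hgt_seg.
    by rewrite addr_ge0 // mulr_ge0 //; lra.
  have [->|tn0] := eqVneq t 0.
    by rewrite segment_point_0 mul0r addr0 subr0 mul1r.
  have [->|tn1] := eqVneq t 1.
    by rewrite segment_point_1 subrr mul0r add0r mul1r.
  have tp : 0 < t by rewrite lt0r tn0.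
  have tl : 0 < 1 - t by rewrite subr_gt0 lt_neqAle tn1.
  move=> E.
  have h1 : 0 <= (1 - t) * hgt z by rewrite mulr_ge0 // ltW.
  have h2 : 0 <= t * hgt z' by rewrite mulr_ge0 // ltW.
  have z0 : hgt z = 0 by apply: (mulfI (lt0r_neq0 tl)); rewrite mulr0; lra.
  have z0' : hgt z' = 0 by apply: (mulfI (lt0r_neq0 tp)); rewrite mulr0; lra.
  by apply: segment_closed_segment; [rewrite t0|exact: sz|exact: sz'].
have HC : path_hull p `<=` C.
  apply: path_hull_sub => // k kp.
  have [->|ki] := eqVneq k i.
    split => [|_]; first by rewrite /hgt orient_aba mulr0 mul0r.
    by exists 0; rewrite ?lexx ?ler01 // segment_point_0.
  have [->|kj] := eqVneq k j.
    split => [|_]; first by rewrite /hgt orient_abb mulr0 mul0r.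
    by exists 1; rewrite ?lexx ?ler01 // segment_point_1.
  have hk : 0 < hgt (vertex p k) by rewrite divr_gt0 // edge.
  by split => [|E]; [exact: ltW|rewrite E ltxx in hk].
have u0 : edge_normal x y e != 0.
  apply/eqP => E; have := edge_normal_unit xy e2.
  by rewrite E /dotp /= !mul0r addr0 => /eqP; rewrite eq_sym oner_eq0.
split.
  exists (edge_normal x y e), (dotp (edge_normal x y e) y + 0); split => //.
    exists x; split; last exact: path_hull_vertex.
    by apply/edge_lineP; rewrite orient_aba mulr0 mul0r.
  move=> z /HC[+ _]; rewrite /hgt -edge_normal_height; lra.
apply/seteqP; split => z.
  by case=> /edge_lineP zL /HC[_]; apply.
move=> [t t01 ->]; split.
  apply/edge_lineP; rewrite -/(hgt _) hgt_seg /hgt orient_aba orient_abb.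
  by rewrite !mulr0 !mul0r !mulr0 addr0.
by apply: hull_segment_closed => //; exact: path_hull_vertex.
Qed.

Lemma not_hull_edge_separates p i : taut (links p) (vertex p) ->
  (i < links p)%N -> vertex p i != vertex p i.+1 ->
  ~ hull_edge (path_hull p) (vertex p i) (vertex p i.+1) ->
  exists k l, [/\ (k <= links p)%N, (l <= links p)%N &
    orient (vertex p i) (vertex p i.+1) (vertex p k) < 0 <
    orient (vertex p i) (vertex p i.+1) (vertex p l)].
Proof.
move=> tP ip nd nedge.
have n0 : (0 < links p)%N by exact: leq_ltn_trans ip.
have nosided e : e ^+ 2 = 1 -> ~ edge_sided (links p) (vertex p) e i i.+1.
  move=> e2 /(one_sided_support (ltnW ip) ip n0 nd e2) [sL eL].
  by apply: nedge; split => //; exists (edge_line (vertex p i) (vertex p i.+1) e 0).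
have side e : e ^+ 2 = 1 -> exists2 k, (k <= links p)%N &
    e * orient (vertex p i) (vertex p i.+1) (vertex p k) < 0.
  move=> e2; apply: contrapT => none; apply: (nosided e e2) => k kp ki kj.
  have e0 : e != 0.
    by apply/eqP => e0; move: e2; rewrite e0 expr0n => /eqP; rewrite eq_sym oner_eq0.
  have o0 : orient (vertex p i) (vertex p i.+1) (vertex p k) != 0.
    apply: (taut_noncollinear tP) => //; rewrite ?(ltnW ip) // 1?eq_sym //.
    by rewrite neq_ltn ltnSn orbT.
  rewrite lt0r (mulf_neq0 e0 o0) /=.
  by rewrite leNgt; apply/negP => neg; apply: none; exists k.
have [|k kp ok] := side 1; first by rewrite expr1n.
have [|l lp ol] := side (-1); first by rewrite sqrrN expr1n.
by exists k, l; split => //; move: ok ol; rewrite mul1r mulN1r oppr_lt0 => -> ->.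
Qed.

Lemma hull_half_plane p (u : plane) (c : R) :
  (forall k, (k <= links p)%N -> c <= dotp u (vertex p k)) ->
  forall x, path_hull p x -> c <= dotp u x.
Proof.
move=> cv; apply: path_hull_sub => // x y t /andP[t0 t1] cx cy.
have -> : dotp u (segment_point x y t) = (1 - t) * dotp u x + t * dotp u y.
  by rewrite /dotp /= /GRing.scale /=; ring.
have h1 : (1 - t) * c <= (1 - t) * dotp u x by rewrite ler_wpM2l // subr_ge0.
have h2 : t * c <= t * dotp u y by rewrite ler_wpM2l.
lra.
Qed.

Lemma farthest_support p i j m e : (m <= links p)%N -> (0 < links p)%N ->
  vertex p i != vertex p j -> e ^+ 2 = 1 ->
  farthest (links p) (vertex p) e i j m ->
  let x := vertex p i in let y := vertex p j in
  support_line (path_hull p)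
    (edge_line x y e (e * orient x y (vertex p m) / edist x y)).
Proof.
move=> mp n0 xy e2 far x y; have d0 := edist_gt0 xy.
set h := _ / _; set u := edge_normal x y e.
have u0 : u != 0.
  apply/eqP => E; have := edge_normal_unit xy e2.
  by rewrite -/x -/y -/u E /dotp /= !mul0r addr0 => /eqP; rewrite eq_sym oner_eq0.
have neg z : dotp (- u) z = - dotp u z by rewrite /dotp /=; ring.
exists (- u), (- (dotp u y + h)); split.
- by rewrite oppr_eq0.
- apply/seteqP; split => z; rewrite /edge_line /line /= -/u neg => E; lra.
- exists (vertex p m); split; last exact: path_hull_vertex.
  exact/edge_lineP.
- apply: hull_half_plane => k kp; rewrite neg lerN2 -lerBlDl.
  by rewrite edge_normal_height ler_pM2r ?invr_gt0 // far.
Qed.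

Lemma frame_surj o w e y : dotp w w = 1 -> e ^+ 2 = 1 ->
  exists x, frame o w e x = y.
Proof.
rewrite /dotp => w1 e2.
exists (o.1 + w.1 * y.1 - e * w.2 * y.2, o.2 + w.2 * y.1 + e * w.1 * y.2).
apply: plane_eq; rewrite /frame /=.
  rewrite -[RHS]mul1r -w1; ring.
have -> : e * (w.1 * (o.2 + w.2 * y.1 + e * w.1 * y.2 - o.2) -
    w.2 * (o.1 + w.1 * y.1 - e * w.2 * y.2 - o.1)) =
  e ^+ 2 * (w.1 * w.1 + w.2 * w.2) * y.2 by ring.
by rewrite w1 e2 !mul1r.
Qed.

End Final.

Theorem proposition3p4 (R : realType) (N : nat) (eta : seq (R * R))
    (hnonconvex : nonconvex_standard eta) (hmin : length_minimal N eta) :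
  exists (F T M : R * R) (L0 L1 : set (R * R)) (h : R),
    [/\ gap eta F T,
        extreme_point (path_hull eta) M,
        [/\ 0 < h, support_line (path_hull eta) L0,
            support_line (path_hull eta) L1 & parallel_at_distance h L0 L1],
        [/\ L0 F, L0 T & L1 M] &
        (exists (phi : R * R -> R * R) (xF xT xM : R),
          [/\ isometry phi,
              [/\ phi @` L0 = [set x : R * R | x.2 = 0],
                  phi @` L1 = [set x : R * R | x.2 = h] &
                  phi @` path_hull eta `<=` [set x : R * R | 0 <= x.2 <= h]],
              [/\ phi F = (xF, 0), phi T = (xT, 0) & phi M = (xM, h)],
              xF <= xT &
              precedes eta F M /\ precedes eta M T]) /\
        (1 + Num.sqrt 2) * h <= len eta].
Proof.
have [stp nconv] := hnonconvex.
have tP := minimal_taut stp hmin.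
have sp : simple_path eta by case: stp.
have [up n0 ext nd] := standard_open_vertices stp (minimal_not_closed sp hmin).
have [i ip nedge] : exists2 i, (i < links eta)%N &
    ~ hull_edge (path_hull eta) (vertex eta i) (vertex eta i.+1).
  by apply: contrapT => H; apply: nconv => i ip; apply: contrapT => ?; apply: H; exists i.
have [k [l [kp lp sep]]] := not_hull_edge_separates tP ip (simple_link_neq sp ip) nedge.
have [e [f [t [m [e2 /andP[fmt tp] edge far bound]]]]] := taut_gap tP ip kp lp sep.
have [fm mt] := andP fmt.
have mp : (m <= links eta)%N by exact: leq_trans (ltnW mt) tp.
have fp : (f <= links eta)%N by exact: leq_trans (ltnW fm) mp.
have FT : vertex eta f != vertex eta t.
  by apply: nd => //; rewrite neq_ltn (ltn_trans fm mt).
have d0 := edist_gt0 FT.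
set F := vertex eta f in edge far bound FT d0 *.
set T := vertex eta t in edge far bound FT d0 *.
set M := vertex eta m in far bound *.
pose hgt x := e * orient F T x / edist F T.
have h0 : 0 < hgt M.
  by rewrite divr_gt0 // edge // neq_ltn ?fm ?mt ?orbT.
have [sup0 face0] := one_sided_support fp tp n0 FT e2 edge.
have sup1 := farthest_support mp n0 FT e2 far.
have w1 := direction_unit FT.
pose phi := frame T (direction F T) e.
have phi2 x : (phi x).2 = hgt x by exact: frame_height.
have phi_line h : phi @` edge_line F T e h = [set x : R * R | x.2 = h].
  apply/seteqP; split => [_ [x /edge_lineP xh <-]|y yh].
    exact: etrans (phi2 x) xh.
  have [x xy] := frame_surj T y w1 e2.
  by exists x => //; apply/edge_lineP; rewrite -/(hgt x) -phi2 /phi xy.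
have hgt_hull x : path_hull eta x -> 0 <= hgt x <= hgt M.
  move=> Hx; apply/andP; split; rewrite /hgt -edge_normal_height.
    rewrite subr_ge0; apply: hull_half_plane Hx => j jp.
    rewrite -subr_ge0 edge_normal_height; apply: divr_ge0; last exact: ltW.
    have [->|jf] := eqVneq j f; first by rewrite orient_aba mulr0.
    have [->|jt] := eqVneq j t; first by rewrite orient_abb mulr0.
    by apply/ltW/edge.
  rewrite lerBlDr -lerN2.
  set u := edge_normal F T e; have neg z : - dotp u z = dotp (- u) z.
    by rewrite /dotp /=; ring.
  rewrite neg; apply: (hull_half_plane _ Hx) => j jp.
  rewrite -neg lerN2 -lerBlDr edge_normal_height.
  by rewrite ler_pM2r ?invr_gt0 // far.
exists F, T, M, (edge_line F T e 0), (edge_line F T e (hgt M)), (hgt M); split.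
- split; first by split => //; exists (edge_line F T e 0).
  have idx j a : (j <= links eta)%N -> (a <= links eta)%N ->
      vertex eta j = vertex eta a -> j = a.
    by move=> jp ap E; apply/eqP; apply: contraT => ja; have := nd j a jp ap ja; rewrite E eqxx.
  move=> [j jp [[jf jt]|[jt jf]]].
    have E1 := idx _ _ (ltnW jp) fp jf; have E2 := idx _ _ jp tp jt; lia.
  have E1 := idx _ _ (ltnW jp) tp jt; have E2 := idx _ _ jp fp jf; lia.
- exact: ext.
- split => //; exists (edge_normal F T e), (dotp (edge_normal F T e) T).
  by split; rewrite ?edge_normal_unit // /edge_line addr0.
- by split; apply/edge_lineP; rewrite ?orient_aba ?orient_abb ?mulr0 ?mul0r.
- split; last by rewrite /hgt mulrA ler_pdivrMr // lenE [X in _ <= X]mulrC.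
  exists phi, (- edist F T), 0, (phi M).1; split.
  + by move=> x y; exact: frame_edist.
  + split => // _ [x /hgt_hull xh <-]; rewrite -phi2 in xh; exact: xh.
  + split; apply: plane_eq; rewrite ?phi2 //=.
    * exact: frame_first.
    * by rewrite /hgt orient_aba mulr0 mul0r.
    * by rewrite /phi /frame /= !subrr !mulr0 addr0.
    * by rewrite /hgt orient_abb mulr0 mul0r.
  + by rewrite oppr_le0 ltW.
  + have lt j : (j <= links eta)%N -> (j < size eta)%N.
      by move: n0; rewrite /links; case: (size eta).
    by rewrite /precedes /F /T /M /vertex !index_uniq ?mem_nth ?lt.
Qed.
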